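(* (1) If $2<r<\infty$, then $\ell_s^n$ embeds uniformly into $\ell_r$ for all $n\ge1$ if and only if $s=r$ or $s=2$. (2) If $1<s<\min\{2,r\}$ or $s>\max\{2,r\}$ (or $r>2$ and $s\ne r$), then $\ell_{s,q}^n$ does not embed into $\ell_r$ uniformly for any $q\ge1$. In particular, $\ell_s^n$ does not embed into $\ell_r$ uniformly.
   Context: $\ell_r$ is the usual Banach space of $r$-summable real sequences, and $\ell_s^n$ is $\mathbb{R}^n$ with the norm $\left(\sum_{k=1}^n|a_k|^s\right)^{1/s}$. $\ell_{s,q}^n$ is $\mathbb{R}^n$ with the (quasi-)norm $\|(a_k)\|_{s,q}=\left(\sum_{k=1}^n(a_k^* )^q\left(k^{q/s}-(k-1)^{q/s}\right)\right)^{1/q}$, where $(a_k^* )$ is the decreasing rearrangement of $(|a_k|)$; for $q=s$ this is $\ell_s^n$. A family $E_n$, $n\ge1$, of finite-dimensional spaces embeds uniformly into a Banach space $X$ if for every $n$ there is an injective linear operator $T_n:E_n\to X$ with $\sup_n\|T_n\|\,\|T_n^{-1}\|<\infty$, where $T_n^{-1}$ is defined on $T_n(E_n)$.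
   Formalization: In part (2), in the case r>2 and s≠r, the pair s=q=2 is excluded from the Lorentz claim and s=2 from the claim on ℓ_s^n, because ℓ_2^n does embed uniformly into ℓ_r by part (1). *)

(* Defs.v *)
From HB Require Import structures.
From mathcomp Require Import all_boot all_order all_algebra.
From mathcomp Require Import all_classical all_reals all_analysis.

Set Implicit Arguments.
Unset Strict Implicit.
Unset Printing Implicit Defensive.

Import Order.TTheory GRing.Theory Num.Theory.

Local Open Scope classical_set_scope.
Local Open Scope ring_scope.

Definition lnorm (R : realType) (s : R) (n : nat) (a : 'rV[R]_n) : R :=
  (\sum_(k < n) `|a ord0 k| `^ s) `^ s^-1.

(* The terms of the sequence are numbered from 0: [decr_rearr a k] is
   a^*_(k+1). *)
Definition decr_rearr (R : realType) (n : nat) (a : 'rV[R]_n) (k : nat) : R :=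
  nth 0 (sort >=%R [seq `|a ord0 i| | i <- enum 'I_n]) k.

Definition lorentz_norm (R : realType) (s q : R) (n : nat) (a : 'rV[R]_n) : R :=
  (\sum_(k < n) decr_rearr a k `^ q *
     (k.+1%:R `^ (q / s) - k%:R `^ (q / s))) `^ q^-1.

(* A sequence has finite L^r-norm for the counting measure iff it is
   r-summable, and no two distinct sequences are identified since only the
   empty set is negligible; see also [Lnorm_counting]. *)
Definition ell (R : realType) (r : R) (r1 : (1 <= r%:E)%E) : lmodType R :=
  LfunType (@counting nat R) r1.

Definition ell_norm (R : realType) (r : R) (r1 : (1 <= r%:E)%E)
    (x : ell r1) : R :=
  fine 'N[counting]_(r%:E)[EFin \o (x : LfunType (@counting nat R) r1)].

(* sup of NV (f x) over the x in the domain D with NU x <= 1. It takes values in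
   \bar R, so that an unbounded [f] has norm +oo. *)
Definition opnorm (R : realType) (U V : Type) (D : set U)
    (NU : U -> R) (NV : V -> R) (f : U -> V) : \bar R :=
  ereal_sup [set (NV (f x))%:E | x in [set x | D x /\ NU x <= 1]].

(* ||T|| ||T^-1||, where T^-1 is defined on the range of T. *)
Definition distortion (R : realType) (U V : lmodType R)
    (NU : U -> R) (NV : V -> R) (T : U -> V) : \bar R :=
  (opnorm setT NU NV T *
   opnorm (range T) NV NU ('pinv_(fun=> 0%R) setT T))%E.

Definition embeds_uniformly (R : realType) (NE : forall n, 'rV[R]_n -> R)
    (X : lmodType R) (NX : X -> R) : Prop :=
  exists T : forall n, {linear 'rV[R]_n -> X},
    (forall n, (0 < n)%N -> injective (T n)) /\
    (ereal_sup [set distortion (@NE n) NX (T n) | n in [set n | (0 < n)%N]]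
       < +oo)%E.

(* Main.v *)
Require Import Defs.
From HB Require Import structures.
From mathcomp Require Import all_boot all_order all_algebra.
From mathcomp Require Import all_classical all_reals all_analysis.
From mathcomp Require Import ring lra.
Import Order.TTheory GRing.Theory Num.Theory.
Local Open Scope ring_scope.

(** The r-th power of the norm of ell_r is a sum over coordinates. Hence every
    inequality between combinations of r-th powers |sum_i c_i t_i|^r that holds
    for all real t_i also holds for vectors of ell_r, with the norm in place of
    the absolute value ([lifts_le]). The proof consists in choosing good scalar
    inequalities. They concern moments of S = sum_i xi_i t_i, where the xi_i are
    independent, equal to 1 and -1 with probability d/2 each and to 0 otherwise.

    Non-embedding for s <> 2. The norms of ell_s and of the Lorentz spaces of
    exponent s give the value m^(1/s) to a vector with m entries 1 or -1 and zeros
    elsewhere. If x_1, ..., x_n are the images of the unit vectors under a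
    uniform embedding, then the average of ||sum_i xi_i x_i||^r over all signs is
    of order n^(r/s), while the x_i have comparable norms. Khintchine's inequality
    gives the type and the cotype of ell_r, and these exclude s < min (2, r) and
    s > max (2, r). For 2 < s < r one averages over random subsets instead.
    Rosenthal's inequality ([rosenthal], transferred in [avg_rosenthal]) says that
    the average over subsets of density d is at most a constant times
    d sum_i ||x_i||^r + d^(r/2) A, with A the average over all signs. For
    d = n^(-1/2) this is of smaller order than (n^(1/2))^(r/s), which is what the
    embedding requires. All these cases are in [no_flat_embedding].

    Non-embedding for s = 2, q <> 2 and r > 2. The type 2 of ell_r bounds the
    norm of every vector by a multiple of its euclidean norm. Averaging over
    cyclic permutations of the coordinates, under which the Lorentz norm is
    invariant, gives the reverse bound. But the Lorentz norm of the vector with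
    k-th entry k^(-1/2) is of order (log n)^(1/q), and its euclidean norm is of
    order (log n)^(1/2) ([no_lorentz2_embedding]).

    Embeddings. ell_r^n is spanned by n unit vectors of ell_r. For r > 2, ell_2^n
    is spanned by n random signs, realized as functions on the finite set of
    outcomes: by Khintchine's inequality their r-th moments are equivalent to the
    euclidean norm ([embeds_ell_2]). *)

Set Implicit Arguments.
Unset Strict Implicit.
Unset Printing Implicit Defensive.
Import numFieldNormedType.Exports.
Local Open Scope classical_set_scope.

(** * Inequalities between powers *)

Section Powers.
Context {R : realType}.
Implicit Types p r x y h m v : R.

Lemma ler_powR2 p x y : 0 <= p -> 0 <= x -> x <= y -> x `^ p <= y `^ p.
Proof.
by move=> p0 x0 xy; apply: ge0_ler_powR; rewrite ?nnegrE// (le_trans x0).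
Qed.

Lemma powRK p x : p != 0 -> 0 <= x -> (x `^ p) `^ p^-1 = x.
Proof. by move=> p0 x0; rewrite -powRrM mulfV// powRr1. Qed.

Lemma powRVK p x : p != 0 -> 0 <= x -> (x `^ p^-1) `^ p = x.
Proof. by move=> p0 x0; rewrite -powRrM mulVf// powRr1. Qed.

Lemma powR_inv x p : 0 <= x -> (x^-1) `^ p = (x `^ p)^-1.
Proof. by move=> x0; rewrite -powR_inv1// -powRrM mulN1r powRN. Qed.

Lemma sqr_powR p x : (x ^+ 2) `^ (p / 2) = `|x| `^ p.
Proof.
by rewrite -real_normK ?num_real// -powR_mulrn// -powRrM mulrCA divff ?mulr1.
Qed.

(** The graph of the convex function y^p lies above its tangent at m. This is
    Young's inequality for y and m^(p-1), with exponents p and p / (p - 1). *)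
Lemma powR_tangent p y m : 1 <= p -> 0 <= y -> 0 <= m ->
  m `^ p + p * m `^ (p - 1) * (y - m) <= y `^ p.
Proof.
rewrite le_eqVlt => /predU1P[<- y0 m0|p1 y0 m0].
  by rewrite subrr powRr0 !powRr1// !mul1r subrKC.
have p0 : 0 < p by rewrite (lt_trans _ p1).
have p10 : 0 < p - 1 by rewrite subr_gt0.
have q0 : 0 < p / (p - 1) by rewrite divr_gt0.
have := conjugate_powR y0 (powR_ge0 m (p - 1)) p0 q0.
have -> : p^-1 + (p / (p - 1))^-1 = 1 by field; rewrite !gt_eqF.
move=> /(_ erefl); rewrite -powRrM.
have -> : (p - 1) * (p / (p - 1)) = p by field; rewrite gt_eqF.
rewrite -(ler_pM2l p0) -(mulr_powRB1 m0 p0).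
have -> : p * (y `^ p / p + m * m `^ (p - 1) / (p / (p - 1))) =
  y `^ p + (p - 1) * (m * m `^ (p - 1)) by field; rewrite !gt_eqF.
by lra.
Qed.

(** For a monotone and affine functional L, the inequality is L applied to the
    tangent inequality at m = L y. Random averages and weighted finite sums are
    both covered. *)
Lemma jensen_powR (A : Type) (L : (A -> R) -> R) p (y : A -> R) :
  (forall f g : A -> R, (forall i, f i <= g i) -> L f <= L g) ->
  (forall a b (f : A -> R), L (fun i => a * f i + b) = a * L f + b) ->
  1 <= p -> (forall i, 0 <= y i) ->
  L y `^ p <= L (fun i => y i `^ p).
Proof.
move=> L_mono L_aff p1 y0; set m := L y.
have m0 : 0 <= m.
  have <- : L (fun i => 0 * y i + 0) = 0 by rewrite L_aff mul0r addr0.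
  by apply: L_mono => i; rewrite mul0r addr0.
have <- : L (fun i => (p * m `^ (p - 1)) * y i +
                      (m `^ p - p * m `^ (p - 1) * m)) = m `^ p.
  by rewrite L_aff -/m; ring.
apply: L_mono => i; have := powR_tangent p1 (y0 i) m0; lra.
Qed.

Lemma jensen_sum n (w y : nat -> R) p :
  (forall i, 0 <= w i) -> \sum_(i < n) w i = 1 -> 1 <= p ->
  (forall i, 0 <= y i) ->
  (\sum_(i < n) w i * y i) `^ p <= \sum_(i < n) w i * y i `^ p.
Proof.
move=> w0 w1 p1 y0.
apply: (jensen_powR (L := fun f => \sum_(i < n) w i * f i)) => //.
  by move=> f g fg; apply: ler_sum => i _; rewrite ler_wpM2l.
move=> a b f; rewrite mulr_sumr -{2}[b]mul1r -w1 mulr_suml -big_split/=.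
by apply: eq_bigr => i _; ring.
Qed.

Lemma powR_midpoint r x h : 1 <= r ->
  `|x| `^ r <= (`|x + h| `^ r + `|x - h| `^ r) / 2.
Proof.
move=> r1.
have a1 := powR_tangent r1 (normr_ge0 (x + h)) (normr_ge0 x).
have a2 := powR_tangent r1 (normr_ge0 (x - h)) (normr_ge0 x).
have : 0 <= r * `|x| `^ (r - 1) * (`|x + h| + `|x - h| - 2 * `|x|).
  rewrite !mulr_ge0 ?powR_ge0 ?(le_trans _ r1)// subr_ge0.
  have -> : 2 * `|x| = `|(x + h) + (x - h)|.
    have -> : (x + h) + (x - h) = 2 * x by ring.
    by rewrite normrM ger0_norm.
  exact: ler_normD.
by lra.
Qed.

(** With w = exp |v|, the left-hand side minus 2 is (w - 1)^2 / w, and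
    w - 1 <= |v| w since 1 - |v| <= exp (- |v|). *)
Lemma expR_cosh_le v : expR v + expR (- v) <= 2 + v ^+ 2 * expR `|v|.
Proof.
wlog v0 : v / 0 <= v.
  move=> H; have [/H//|/ltW v0] := leP 0 v.
  have := H (- v); rewrite oppr_ge0 normrN sqrrN opprK => /(_ v0).
  by rewrite addrC.
rewrite ger0_norm//.
have e1 : expR v * expR (- v) = 1 by rewrite -expRD subrr expR0.
have e2 : 1 - v <= expR (- v) by rewrite expR_ge1Dx.
have e0 := expR_gt0 v; have e0' := expR_gt0 (- v).
have h : 0 <= expR v - 1 <= v * expR v.
  by apply/andP; split; [rewrite subr_ge0 -expR0 ler_expR|nra].
have : (expR v - 1) ^+ 2 <= (v * expR v) ^+ 2.
  by case/andP: h => h1 h2; rewrite lerXn2r// nnegrE// (le_trans h1).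
rewrite -(ler_pM2r e0').
have -> : (v * expR v) ^+ 2 * expR (- v) = v ^+ 2 * expR v.
  by rewrite exprMn -mulrA [expR v ^+ 2]expr2 -mulrA e1 mulr1.
have -> : (expR v - 1) ^+ 2 * expR (- v) =
  expR v * (expR v * expR (- v)) - 2 * (expR v * expR (- v)) + expR (- v) by ring.
by rewrite e1; lra.
Qed.

Definition diff2_const r : R := r ^+ 2 * expR r + 2 `^ r.

Lemma diff2_const_ge0 r : 0 <= diff2_const r.
Proof. by rewrite addr_ge0 ?powR_ge0// mulr_ge0 ?sqr_ge0 ?expR_ge0. Qed.

(** If |x| <= |h|, both terms on the left are at most (2 |h|)^r. Otherwise put
    u = h / x, in [-1, 1]: since (1 + u)^r <= exp (r u), the left-hand side is at
    most |x|^r cosh (r u), which is |x|^r (1 + O(u^2)). The linear term cancels by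
    symmetry; this is what makes the moment recursion for random sums work. *)
Lemma powR_diff2 r x h : 2 <= r ->
  (`|x + h| `^ r + `|x - h| `^ r) / 2 <=
  `|x| `^ r + diff2_const r * (h ^+ 2 * `|x| `^ (r - 2) + `|h| `^ r).
Proof.
move=> r2; have r0 : 0 <= r by rewrite (le_trans _ r2).
have A0 := powR_ge0 `|x| (r - 2); have B0 := powR_ge0 `|h| r.
have C0 := powR_ge0 `|x| r; have D0 := sqr_ge0 h.
have K1 : 0 <= r ^+ 2 * expR r by rewrite mulr_ge0 ?sqr_ge0 ?expR_ge0.
have K2 := powR_ge0 2 r.
have [xh|hx] := leP `|x| `|h|.
  have le y : `|y| <= `|x| + `|h| -> `|y| `^ r <= 2 `^ r * `|h| `^ r.
    move=> yxh; rewrite -powRM//; apply: ler_powR2 => //.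
    by rewrite (le_trans yxh)// mulr_natl mulr2n lerD2r.
  have := le _ (ler_normD x h); have := le _ (ler_normB x h).
  rewrite /diff2_const => h1 h2.
  have : 0 <= r ^+ 2 * expR r * (h ^+ 2 * `|x| `^ (r - 2) + `|h| `^ r).
    by rewrite mulr_ge0// addr_ge0// mulr_ge0.
  have := mulr_ge0 K2 (mulr_ge0 D0 A0).
  by rewrite mulrDl mulrDr; lra.
have x0 : x != 0 by rewrite -normr_gt0 (le_lt_trans _ hx).
have nx0 : 0 < `|x| by rewrite normr_gt0.
pose u := h / x.
have u1 : `|u| <= 1 by rewrite normf_div ler_pdivrMr// mul1r ltW.
have e (w : R) : `|w| <= 1 -> `|x + w * x| `^ r <= `|x| `^ r * expR (w * r).
  move=> w1; rewrite -{1}[x]mul1r -mulrDl normrM mulrC powRM// ler_wpM2l//.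
  rewrite expRM ler_powR2//.
  by rewrite ger0_norm ?expR_ge1Dx//; move: w1; rewrite ler_norml; lra.
have := e _ u1; have := e (- u); rewrite normrN => /(_ u1).
rewrite mulNr /u divfK// -/u mulNr => h1 h2.
have h3 := expR_cosh_le (u * r).
have h4 : expR `|u * r| <= expR r.
  by rewrite ler_expR normrM [X in _ * X]ger0_norm// ler_piMl.
have h5 : (u * r) ^+ 2 * expR `|u * r| <= u ^+ 2 * (r ^+ 2 * expR r).
  by rewrite exprMn -mulrA !ler_wpM2l ?sqr_ge0.
have h6 : `|x| `^ r * u ^+ 2 = h ^+ 2 * `|x| `^ (r - 2).
  have -> : `|x| `^ r = `|x| `^ (r - 2) * x ^+ 2.
    rewrite -real_normK ?num_real// -powR_mulrn// -powRD ?subrK//.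
    by rewrite (gt_eqF nx0) implybT.
  by rewrite -mulrA -exprMn mulrC /u mulrC [x * _]mulrC divfK// mulrC.
rewrite /diff2_const mulrDl mulrDr -!h6.
have h7 : `|x| `^ r * (expR (u * r) + expR (- (u * r))) <=
   `|x| `^ r * (2 + u ^+ 2 * (r ^+ 2 * expR r)).
  by rewrite ler_wpM2l// (le_trans h3)// lerD2l.
have k1 := mulr_ge0 K1 B0.
have k2 := mulr_ge0 K2 (addr_ge0 (mulr_ge0 C0 (sqr_ge0 u)) B0).
have k3 := mulr_ge0 (mulr_ge0 C0 (sqr_ge0 u)) K1.
lra.
Qed.

Lemma sum_powR_le n (b : nat -> R) p : 1 <= p -> (forall i, 0 <= b i) ->
  \sum_(i < n) b i `^ p <= (\sum_(i < n) b i) `^ p.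
Proof.
move=> p1 b0; set B := \sum_(i < n) b i.
have p0 : 0 < p by rewrite (lt_le_trans _ p1).
have B0 : 0 <= B by apply: sumr_ge0.
rewrite -(mulr_powRB1 B0 p0) mulr_suml; apply: ler_sum => i _.
rewrite -(mulr_powRB1 (b0 i) p0) ler_wpM2l// ler_powR2 ?subr_ge0//.
by rewrite /B (bigD1 i)//= lerDl; apply: sumr_ge0.
Qed.

(** The inequality [sum_powR_le] for the exponent 1 / p and the numbers b_i^p. *)
Lemma powR_sum_le n (b : nat -> R) p : 0 < p -> p <= 1 ->
  (forall i, 0 <= b i) ->
  (\sum_(i < n) b i) `^ p <= \sum_(i < n) b i `^ p.
Proof.
move=> p0 p1 b0.
have Sp0 : 0 <= \sum_(i < n) b i `^ p by apply: sumr_ge0 => i _; rewrite powR_ge0.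
rewrite -[leRHS](powRVK (p := p)) ?gt_eqF//.
apply: ler_powR2; [exact: ltW|by apply: sumr_ge0|].
have := @sum_powR_le n (fun i => b i `^ p) p^-1 _ _.
rewrite invf_ge1// => /(_ p1 (fun=> powR_ge0 _ _)).
by under eq_bigr do rewrite powRK ?gt_eqF//.
Qed.

Lemma powR_growth (a b C x : R) : a < b -> `|C| `^ (b - a)^-1 < x ->
  C * x `^ a < x `^ b.
Proof.
move=> ab Cx; have ba : 0 < b - a by rewrite subr_gt0.
have x0 : 0 < x by rewrite (le_lt_trans _ Cx)// powR_ge0.
rewrite -[b](subrK a) powRD; last by rewrite (gt_eqF x0) implybT.
rewrite ltr_pM2r ?powR_gt0// (le_lt_trans (ler_norm C))//.
rewrite -[`|C|](powRVK (p := b - a)) ?gt_eqF//.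
by apply: gt0_ltr_powR; rewrite ?nnegrE ?powR_ge0// ltW.
Qed.

Lemma no_powR_bound (a b C : R) : a < b ->
  ~ forall n, (0 < n)%N -> n%:R `^ b <= C * n%:R `^ a.
Proof.
move=> ab /(_ (Num.truncn (`|C| `^ (b - a)^-1)).+1 isT).
by rewrite leNgt powR_growth// Num.Theory.truncnS_gt.
Qed.

Lemma harmonic_sum_unbounded (C : R) :
  exists2 n, (0 < n)%N & C < \sum_(k < n) k.+1%:R^-1.
Proof.
apply: contrapT => h; apply: (@dvg_harmonic R).
apply: nondecreasing_is_cvgn.
  by apply: nondecreasing_series => n _ _; exact: harmonic_ge0.
exists C => _ [[_ <-|n _ <-]].
  rewrite /series /= big_geq// leNgt; apply/negP => C0; apply: h; exists 1%N => //.
  by rewrite big_ord1 invr1 (lt_trans C0).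
by rewrite /series /= big_mkord leNgt; apply/negP => C0; apply: h; exists n.+1.
Qed.

End Powers.

(** * Moments of random sums *)

Section Signs.
Context {R : realType}.
Implicit Types (d r : R) (xi t a : nat -> R) (g : (nat -> R) -> R).

Definition set_coef xi n (c : R) : nat -> R := fun i => if i == n then c else xi i.

(** The law of n independent coefficients, each equal to 1 and to -1 with
    probability d / 2 and to 0 otherwise, as a list of weights and coefficient
    sequences. For d = 1 the coefficients are random signs; a small d selects a
    random set of indices and gives it random signs. An explicit list makes the
    finite system of outcomes available as a set of coordinates of ell_r. *)
Fixpoint outcomes d n : seq (R * (nat -> R)) :=
  if n is m.+1 then
    flatten [seq [:: ((1 - d) * p.1, set_coef p.2 m 0);
                     (d / 2 * p.1, set_coef p.2 m 1);
                     (d / 2 * p.1, set_coef p.2 m (-1))] | p <- outcomes d m]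
  else [:: (1, fun=> 0)].

Definition expect d n g : R := \sum_(p <- outcomes d n) p.1 * g p.2.

Definition average_last d n g xi : R :=
  (1 - d) * g (set_coef xi n 0) + d * ((g (set_coef xi n 1) + g (set_coef xi n (-1))) / 2).

Lemma expect0 d g : expect d 0 g = g (fun=> 0).
Proof. by rewrite /expect big_seq1 mul1r. Qed.

Lemma expectS d n g : expect d n.+1 g = expect d n (average_last d n g).
Proof.
rewrite /expect /= big_flatten big_map; apply: eq_bigr => p _.
by rewrite !big_cons big_nil /= /average_last; ring.
Qed.

Lemma eq_expect d n g1 g2 : g1 =1 g2 -> expect d n g1 = expect d n g2.
Proof. by move=> /funext ->. Qed.

Lemma expect_cst d n (c : R) : expect d n (fun=> c) = c.
Proof.
elim: n => [|n IH]; first by rewrite expect0.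
by rewrite expectS -[RHS]IH; apply: eq_expect => xi; rewrite /average_last; field.
Qed.

Lemma expect_scale d n (c : R) g :
  expect d n (fun xi => c * g xi) = c * expect d n g.
Proof. by rewrite /expect mulr_sumr; apply: eq_bigr => p _; ring. Qed.

Lemma expect_add d n g1 g2 :
  expect d n (fun xi => g1 xi + g2 xi) = expect d n g1 + expect d n g2.
Proof. by rewrite /expect -big_split/=; apply: eq_bigr => p _; ring. Qed.

Lemma expect_affine d n (c b : R) g :
  expect d n (fun xi => c * g xi + b) = c * expect d n g + b.
Proof. by rewrite expect_add expect_scale expect_cst. Qed.

(** Only outcomes of positive weight count, so for d = 1 no coefficient
    vanishes. *)
Lemma le_expect_supp d n g1 g2 : 0 <= d <= 1 ->
  (forall xi, (forall i, (i < n)%N -> `|xi i| = 1 \/ (d < 1 /\ xi i = 0)) ->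
     g1 xi <= g2 xi) ->
  expect d n g1 <= expect d n g2.
Proof.
move=> /andP[d0 d1]; elim: n g1 g2 => [|n IH] g1 g2 g12.
  by rewrite !expect0; exact: g12.
rewrite !expectS; apply: IH => xi xi1.
have value_le c : `|c| = 1 \/ (d < 1 /\ c = 0) ->
    g1 (set_coef xi n c) <= g2 (set_coef xi n c).
  move=> hc; apply: g12 => i; rewrite ltnS leq_eqVlt /set_coef.
  by case: eqP => //= _; exact: xi1.
apply: lerD.
  move: d1; rewrite le_eqVlt => /predU1P[->|d1]; first by rewrite subrr !mul0r.
  by rewrite ler_wpM2l ?subr_ge0 ?(ltW d1)//; apply: value_le; right.
rewrite ler_wpM2l// ler_wpM2r// lerD//; apply: value_le; left.
  by rewrite normr1.
by rewrite normrN1.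
Qed.

Lemma le_expect d n g1 g2 : 0 <= d <= 1 -> (forall xi, g1 xi <= g2 xi) ->
  expect d n g1 <= expect d n g2.
Proof. by move=> d01 g12; apply: le_expect_supp => // xi _; exact: g12. Qed.

Lemma expect_ge0 d n g : 0 <= d <= 1 -> (forall xi, 0 <= g xi) ->
  0 <= expect d n g.
Proof. by move=> d01 g0; rewrite -(expect_cst d n 0); exact: le_expect. Qed.

Lemma jensen_expect d n g p : 0 <= d <= 1 -> 1 <= p -> (forall xi, 0 <= g xi) ->
  expect d n g `^ p <= expect d n (fun xi => g xi `^ p).
Proof.
move=> d01 p1 g0; apply: (jensen_powR (L := expect d n)) => //.
  by move=> f h; exact: le_expect.
by move=> c b f; exact: expect_affine.
Qed.

Lemma jensen_expect_concave d n g p : 0 <= d <= 1 -> 0 < p -> p <= 1 ->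
  (forall xi, 0 <= g xi) -> expect d n (fun xi => g xi `^ p) <= expect d n g `^ p.
Proof.
move=> d01 p0 p1 g0.
have Ep0 : 0 <= expect d n (fun xi => g xi `^ p).
  by apply: expect_ge0 => // xi; exact: powR_ge0.
rewrite -[leLHS](powRVK (p := p)) ?gt_eqF//.
apply: ler_powR2; [exact: ltW|exact: powR_ge0|].
have := @jensen_expect d n (fun xi => g xi `^ p) p^-1 d01.
rewrite invf_ge1// => /(_ p1 (fun=> powR_ge0 _ _)) /le_trans; apply.
rewrite le_eqVlt (_ : expect d n _ = expect d n g) ?eqxx//.
by apply: eq_expect => xi; rewrite powRK ?gt_eqF.
Qed.

Definition walk n t xi : R := \sum_(i < n) xi i * t i.

Lemma walk_set_coef n t xi (c : R) : walk n.+1 t (set_coef xi n c) = walk n t xi + c * t n.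
Proof.
rewrite /walk big_ord_recr /= {2}/set_coef eqxx; congr (_ + _).
by apply: eq_bigr => i _; rewrite /set_coef ltn_eqF.
Qed.

(** Conditioning on the first n coefficients: a moment of the sum of n + 1 terms
    is an average of symmetrized values at the sum of n terms. *)
Lemma expect_walkS d n t (f : R -> R) :
  expect d n.+1 (fun xi => f (walk n.+1 t xi)) =
  expect d n (fun xi => (1 - d) * f (walk n t xi) +
     d * ((f (walk n t xi + t n) + f (walk n t xi - t n)) / 2)).
Proof.
rewrite expectS; apply: eq_expect => xi.
by rewrite /average_last !walk_set_coef mul0r mul1r mulN1r addr0.
Qed.

Definition sumsq n t : R := \sum_(i < n) t i ^+ 2.

Lemma sumsq_ge0 n t : 0 <= sumsq n t.
Proof. by apply: sumr_ge0 => i _; exact: sqr_ge0. Qed.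

Lemma expect_walk_sqr d n t : expect d n (fun xi => walk n t xi ^+ 2) = d * sumsq n t.
Proof.
elim: n => [|n IH]; first by rewrite expect0 /walk /sumsq !big_ord0 expr0n mulr0.
rewrite (expect_walkS d n t (fun z => z ^+ 2)) /sumsq big_ord_recr /= mulrDr -IH.
rewrite -[X in _ = _ + X](expect_cst d n) -expect_add; apply: eq_expect => xi.
by field.
Qed.

Lemma expect_walk_pow4 n t :
  expect 1 n (fun xi => walk n t xi ^+ 4) <= 3 * sumsq n t ^+ 2.
Proof.
elim: n => [|n IH].
  by rewrite expect0 /walk /sumsq !big_ord0 !expr0n mulr0.
rewrite (expect_walkS 1 n t (fun z => z ^+ 4)) /sumsq big_ord_recr /=.
rewrite -/(sumsq n t).
rewrite (eq_expect _ _ (g2 := fun xi => walk n t xi ^+ 4 +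
   ((6 * t n ^+ 2) * walk n t xi ^+ 2 + t n ^+ 4))); last by move=> xi; field.
rewrite expect_add expect_affine expect_walk_sqr mul1r.
have -> : t n ^+ 4 = (t n ^+ 2) ^+ 2 by rewrite -exprM.
move: IH (sqr_ge0 (t n ^+ 2)); set A := expect _ _ _; set B := sumsq n t.
set s := t n ^+ 2; nra.
Qed.

(** Jensen's inequality for the exponent r / 2 >= 1, since the second moment of
    the sum is sumsq t. This is the trivial half of Khintchine's inequality; the
    next lemma is the same argument for r / 2 <= 1. *)
Lemma expect_walk_ge n t r : 2 <= r ->
  sumsq n t `^ (r / 2) <= expect 1 n (fun xi => `|walk n t xi| `^ r).
Proof.
move=> r2; rewrite -[sumsq n t]mul1r -expect_walk_sqr.
apply: (le_trans (jensen_expect n _ (p := r / 2) _ _)); rewrite ?ler01 ?lexx//.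
- by rewrite ler_pdivlMr// mul1r.
- by move=> xi; exact: sqr_ge0.
by apply: le_expect; rewrite ?ler01 ?lexx// => xi; rewrite sqr_powR.
Qed.

Lemma expect_walk_le n t r : 0 < r -> r <= 2 ->
  expect 1 n (fun xi => `|walk n t xi| `^ r) <= sumsq n t `^ (r / 2).
Proof.
move=> r0 r2; rewrite -[sumsq n t]mul1r -expect_walk_sqr.
apply: le_trans (jensen_expect_concave n (p := r / 2) _ _ _ _); rewrite ?ler01 ?lexx//.
- by apply: le_expect; rewrite ?ler01 ?lexx// => xi; rewrite sqr_powR.
- by rewrite divr_gt0.
- by rewrite ler_pdivrMr// mul1r.
- by move=> xi; exact: sqr_ge0.
Qed.

(** The half of Khintchine's inequality that is not a case of Jensen's. A
    variable whose fourth moment is at most 3 times the square of its second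
    moment B cannot concentrate near 0: |z|^r is bounded below by a combination of
    z^2 and z^4 whose expectation is at least B^(r/2) / 4. *)
Lemma expect_walk_ge_small n t r : 0 < r -> r <= 2 ->
  sumsq n t `^ (r / 2) / 4 <= expect 1 n (fun xi => `|walk n t xi| `^ r).
Proof.
move=> r0 r2.
have := sumsq_ge0 n t; rewrite le_eqVlt => /predU1P[<-|B0].
  rewrite powR0 ?mul0r ?mulf_neq0 ?invr_eq0 ?gt_eqF//.
  by apply: expect_ge0 => [|xi]; rewrite ?ler01 ?lexx ?powR_ge0.
set B := sumsq n t in B0 *.
have key (z : R) : B `^ (r / 2) * (z ^+ 2 / B - z ^+ 4 / (4 * B ^+ 2)) <= `|z| `^ r.
  pose u := z ^+ 2 / B.
  have u0 : 0 <= u by rewrite divr_ge0 ?sqr_ge0// ltW.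
  have -> : `|z| `^ r = B `^ (r / 2) * u `^ (r / 2).
    by rewrite -powRM ?(ltW B0)// /u mulrC divfK ?gt_eqF// sqr_powR.
  have -> : z ^+ 2 / B - z ^+ 4 / (4 * B ^+ 2) = u - u ^+ 2 / 4.
    by rewrite /u; field; rewrite gt_eqF.
  rewrite ler_wpM2l ?powR_ge0//.
  (* u - u^2 / 4 is at most u, and at most 1; compare u^(r/2) with u for u <= 1
     and with 1 for u > 1 *)
  have [u1|u1] := leP u 1.
    have : u <= u `^ (r / 2).
      have := u0; rewrite le_eqVlt => /predU1P[<-|up]; first exact: powR_ge0.
      by apply: ger1_powR; rewrite ?up ?u1// ler_pdivrMr// mul1r.
    have := sqr_ge0 u; lra.
  have : 1 <= u `^ (r / 2).
    by rewrite -{1}(powRr0 u) ler_powR ?(ltW u1)// divr_ge0// ltW.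
  have := sqr_ge0 (u - 2); rewrite sqrrB; lra.
apply: le_trans (le_expect n _ (fun xi => key (walk n t xi))); last by rewrite ler01 lexx.
rewrite expect_scale ler_wpM2l ?powR_ge0//.
rewrite (eq_expect _ _ (g2 := fun xi => B^-1 * walk n t xi ^+ 2 +
    (- (4 * B ^+ 2)^-1) * walk n t xi ^+ 4)); last by move=> xi; ring.
rewrite expect_add !expect_scale expect_walk_sqr mul1r -/B mulVf ?gt_eqF// mulNr.
have := expect_walk_pow4 n t; rewrite -/B => h4.
have : (4 * B ^+ 2)^-1 * expect 1 n (fun xi => walk n t xi ^+ 4) <= 3 / 4.
  rewrite mulrC ler_pdivrMr ?mulr_gt0 ?exprn_gt0//.
  by apply: (le_trans h4); lra.
by lra.
Qed.

Definition sumpow n t r : R := \sum_(i < n) `|t i| `^ r.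

Lemma sumpow_ge0 n t r : 0 <= sumpow n t r.
Proof. by apply: sumr_ge0 => i _; exact: powR_ge0. Qed.

Lemma sum_sqr_powR n t r :
  \sum_(i < n) (t i ^+ 2) `^ (r / 2) = sumpow n t r.
Proof. by apply: eq_bigr => i _; rewrite sqr_powR. Qed.

Lemma expect_walk_le_sumpow n t r : 0 < r -> r <= 2 ->
  expect 1 n (fun xi => `|walk n t xi| `^ r) <= sumpow n t r.
Proof.
move=> r0 r2; apply: (le_trans (expect_walk_le n t r0 r2)).
have := @powR_sum_le R n (fun i => t i ^+ 2) (r / 2).
rewrite divr_gt0// ler_pdivrMr// mul1r => /(_ isT r2 (fun=> sqr_ge0 _)).
by rewrite sum_sqr_powR.
Qed.

Lemma expect_walk_ge_sumpow n t r : 2 <= r ->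
  sumpow n t r <= expect 1 n (fun xi => `|walk n t xi| `^ r).
Proof.
move=> r2; apply: le_trans (expect_walk_ge n t r2).
have := @sum_powR_le R n (fun i => t i ^+ 2) (r / 2).
rewrite ler_pdivlMr// mul1r => /(_ r2 (fun=> sqr_ge0 _)).
by rewrite sum_sqr_powR.
Qed.

Definition rosenthal_const r : R :=
  2 * diff2_const r + (2 * diff2_const r) `^ (r / 2).

Lemma rosenthal_const_ge0 r : 0 <= rosenthal_const r.
Proof. by rewrite addr_ge0 ?powR_ge0// mulr_ge0// diff2_const_ge0. Qed.

(** Either the term a or the sublinear term b X^(1 - 2/r) accounts for at least
    half of X. *)
Lemma powR_bootstrap (X a b r : R) : 2 < r -> 0 <= X -> 0 <= a -> 0 <= b ->
  X <= a + b * X `^ (1 - 2 / r) -> X <= 2 * a + (2 * b) `^ (r / 2).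
Proof.
move=> r2 X0 a0 b0 hX; have r0 : 0 < r by rewrite (lt_trans _ r2).
have [h|h] := leP X (2 * a); first by rewrite (le_trans h)// lerDl powR_ge0.
have Xp : 0 < X by rewrite (le_lt_trans _ h)// mulr_ge0.
suff : X <= (2 * b) `^ (r / 2) by move/le_trans; apply; rewrite lerDr mulr_ge0.
have h2 : X `^ (2 / r) <= 2 * b.
  rewrite -(ler_pM2r (powR_gt0 (1 - 2 / r) Xp)) -powRD; last first.
    by rewrite (gt_eqF Xp) implybT.
  rewrite subrKC powRr1//; lra.
have := ler_powR2 (p := r / 2) _ (powR_ge0 _ _) h2.
rewrite -powRrM (_ : 2 / r * (r / 2) = 1) ?powRr1//; last first.
  by field; rewrite gt_eqF.
by apply; rewrite divr_ge0// ltW.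
Qed.

(** Rosenthal's inequality for symmetric variables. Let X_k be the r-th moment of
    the sum S_k of k terms. The second difference estimate [powR_diff2] gives
    X_(k+1) <= X_k + K d (t_k^2 E|S_k|^(r-2) + |t_k|^r), where E|S_k|^(r-2) is at
    most X_k^(1-2/r) by Jensen and X_k <= X_n by convexity. Summing over k bounds
    X_n by A + B X_n^(1-2/r), which [powR_bootstrap] solves for X_n. *)
Lemma rosenthal d n t r : 0 <= d <= 1 -> 2 < r ->
  expect d n (fun xi => `|walk n t xi| `^ r) <=
  rosenthal_const r * (d * sumpow n t r + (d * sumsq n t) `^ (r / 2)).
Proof.
move=> d01 r2; have r0 : 0 < r by rewrite (lt_trans _ r2).
have d0 : 0 <= d by case/andP: d01.
pose X k := expect d k (fun xi => `|walk k t xi| `^ r).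
have X0 k : 0 <= X k by apply: expect_ge0 => // xi; exact: powR_ge0.
have XS k : X k <= X k.+1.
  rewrite /X (expect_walkS d k t (fun z => `|z| `^ r)); apply: le_expect => // xi.
  have := powR_midpoint (walk k t xi) (t k) (ltW (lt_trans (ltr1n R 2) r2)).
  move/(ler_wpM2l d0); lra.
set K := diff2_const r; have K0 : 0 <= K := diff2_const_ge0 r.
have lower k : expect d k (fun xi => `|walk k t xi| `^ (r - 2)) <= X k `^ (1 - 2 / r).
  have e : r * (1 - 2 / r) = r - 2 by field; rewrite gt_eqF.
  have h0 : 0 < 1 - 2 / r by rewrite subr_gt0 ltr_pdivrMr// mul1r.
  have h1 : 1 - 2 / r <= 1 by rewrite gerBl divr_ge0// ltW.
  have := jensen_expect_concave k d01 h0 h1 (fun xi => powR_ge0 `|walk k t xi| r).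
  by rewrite (eq_expect _ _ (g2 := fun xi => `|walk k t xi| `^ (r - 2)))// => xi;
    rewrite -powRrM e.
have Xmono k : (k <= n)%N -> X k <= X n.
  by move=> kn; apply: (homo_leq (f := X) (r := fun x y : R => x <= y)) => //;
    exact: le_trans.
have rec k : (k <= n)%N -> X k <= K * d * sumpow k t r +
    K * d * sumsq k t * X n `^ (1 - 2 / r).
  elim: k => [_|k IH kn].
    rewrite /X expect0 /walk /sumpow /sumsq !big_ord0 normr0 powR0 ?gt_eqF//.
    by rewrite !mulr0 mul0r addr0.
  rewrite /X (expect_walkS d k t (fun z => `|z| `^ r)).
  apply: (@le_trans _ _ (expect d k (fun xi => `|walk k t xi| `^ r +
      ((d * K * t k ^+ 2) * `|walk k t xi| `^ (r - 2) + d * K * `|t k| `^ r)))).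
    apply: le_expect => // xi.
    have := powR_diff2 (walk k t xi) (t k) (ltW r2).
    move/(ler_wpM2l d0); rewrite -/K; lra.
  rewrite expect_add expect_affine -/(X k) /sumpow /sumsq !big_ord_recr/=.
  have l1 := IH (ltnW kn).
  have l2 : expect d k (fun xi => `|walk k t xi| `^ (r - 2)) <= X n `^ (1 - 2 / r).
    apply: (le_trans (lower k)); apply: ler_powR2 => //.
      by rewrite subr_ge0 ler_pdivrMr// mul1r ltW.
    exact/Xmono/ltnW.
  have := ler_wpM2l (mulr_ge0 (mulr_ge0 d0 K0) (sqr_ge0 (t k))) l2.
  move: l1; rewrite /sumpow /sumsq; lra.
have dA : 0 <= d * sumpow n t r by rewrite mulr_ge0// sumpow_ge0.
have dB : 0 <= d * sumsq n t by rewrite mulr_ge0// sumsq_ge0.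
have := rec n (leqnn n); rewrite -![K * d * _]mulrA.
move/(powR_bootstrap r2 (X0 n) (mulr_ge0 K0 dA) (mulr_ge0 K0 dB)).
rewrite mulrA [2 * (K * _)]mulrA powRM ?mulr_ge0 ?sumsq_ge0// => /le_trans; apply.
rewrite [leRHS]mulrDr lerD// /rosenthal_const -/K ler_wpM2r ?powR_ge0//.
  by rewrite lerDl powR_ge0.
by rewrite lerDr mulr_ge0.
Qed.

(** For d = 1 the first term of Rosenthal's bound is dominated by the second. *)
Lemma khintchine_upper n t r : 2 < r ->
  expect 1 n (fun xi => `|walk n t xi| `^ r) <=
  2 * rosenthal_const r * sumsq n t `^ (r / 2).
Proof.
move=> r2; apply: (le_trans (rosenthal n t _ r2)); first by rewrite ler01 lexx.
rewrite !mul1r [2 * _]mulrC -mulrA ler_wpM2l ?rosenthal_const_ge0//.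
rewrite mulr_natl mulr2n lerD2r.
have := @sum_powR_le R n (fun i => t i ^+ 2) (r / 2).
rewrite ler_pdivlMr// mul1r => /(_ (ltW r2) (fun=> sqr_ge0 _)).
by rewrite sum_sqr_powR.
Qed.

End Signs.

Lemma cvgn_ext {R : realType} (u v : nat -> R) (l : R) :
  u =1 v -> u @ \oo --> l -> v @ \oo --> l.
Proof. by move=> /funext ->. Qed.

(** * Coordinates in ell_r and the transfer principle *)

Section Ell.
Context {R : realType} {r : R} {r1 : (1 <= r%:E)%E}.
Local Notation ell := (@ell R r r1).
Implicit Types x y : ell.

Definition coord x (j : nat) : R := (x : LfunType (@counting nat R) r1) j.

Lemma r_gt0 : 0 < r.
Proof. by move: r1; rewrite lee_fin; exact: lt_le_trans. Qed.

Lemma coordD x y j : coord (x + y) j = coord x j + coord y j.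
Proof. by []. Qed.

Lemma coordZ (c : R) x j : coord (c *: x) j = c * coord x j.
Proof. by []. Qed.

Lemma coord0 j : coord 0 j = 0.
Proof. by []. Qed.

Lemma coord_sum n (c : nat -> R) (x : nat -> ell) j :
  coord (\sum_(i < n) c i *: x i) j = \sum_(i < n) c i * coord (x i) j.
Proof.
exact: (big_morph (coord^~ j) (fun x y => coordD x y j) (coord0 j)).
Qed.

Lemma coord_inj x y : (forall j, coord x j = coord y j) -> x = y.
Proof. by move=> xy; apply/LfuneqP => j; exact: xy. Qed.

(** The r-th power of the norm is the sum over coordinates of |x_j|^r, so it is
    the quantity to which scalar inequalities can be transferred. *)
Definition pnorm x : R := ell_norm x `^ r.

Lemma ell_norm_ge0 x : 0 <= ell_norm x.
Proof. by rewrite fine_ge0// Lnorm_ge0. Qed.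

Lemma pnorm_cvg x :
  (fun J => \sum_(j < J) `|coord x j| `^ r) @ \oo --> pnorm x.
Proof.
have r0 := r_gt0.
have nn (k : nat) : xpredT k -> (0 <= (`|coord x k| `^ r)%:E)%E.
  by move=> _; rewrite lee_fin powR_ge0.
pose S := (\sum_(k <oo) (`|coord x k| `^ r)%:E)%E.
have hS : (ell_norm x)%:E = (S `^ r^-1)%E.
  by rewrite finite_norm_fine Lnorm_counting.
have S0 : (0 <= S)%E by apply: nneseries_ge0 => k _ _; exact: nn.
have Sfin : S = (pnorm x)%:E.
  move: hS; case: S S0 => [s||]//=.
  - rewrite lee_fin => s0 [hS]; rewrite /pnorm hS powRVK// gt_eqF//.
  - by rewrite gt_eqF ?invr_gt0.
have : (fun n => \sum_(0 <= k < n) (`|coord x k| `^ r)%:E)%E @ \oo --> S.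
  exact: (is_cvg_nneseries (P := xpredT) (N := 0%N) (fun n _ => @nn n)).
rewrite Sfin => /fine_cvg; apply: cvgn_ext => n.
by rewrite /= sumEFin/= big_mkord.
Qed.

(** [Psi X] is the sum over all coordinates j of [Phi] evaluated at the j-th
    coordinates of the vectors X_0, X_1, and so on. A scalar inequality between two
    such Phi therefore gives the inequality between the corresponding Psi. *)
Definition lifts (Phi : (nat -> R) -> R) (Psi : (nat -> ell) -> R) :=
  forall X : nat -> ell,
    (fun J => \sum_(j < J) Phi (fun i => coord (X i) j)) @ \oo --> Psi X.

Lemma lifts_pnorm n (c : nat -> R) :
  lifts (fun t => `|\sum_(i < n) c i * t i| `^ r)
        (fun X => pnorm (\sum_(i < n) c i *: X i)).
Proof.
move=> X; apply: cvgn_ext (@pnorm_cvg (\sum_(i < n) c i *: X i)) => J.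
by apply: eq_bigr => j _; rewrite coord_sum.
Qed.

Lemma lifts_scale (c : R) Phi Psi :
  lifts Phi Psi -> lifts (fun t => c * Phi t) (fun X => c * Psi X).
Proof.
move=> h X; apply: cvgn_ext (cvgMl_tmp (h X)) => J.
by rewrite mulr_sumr.
Qed.

Lemma lifts_add Phi1 Psi1 Phi2 Psi2 : lifts Phi1 Psi1 -> lifts Phi2 Psi2 ->
  lifts (fun t => Phi1 t + Phi2 t) (fun X => Psi1 X + Psi2 X).
Proof.
move=> h1 h2 X; apply: cvgn_ext (cvgD (h1 X) (h2 X)) => J.
by rewrite big_split.
Qed.

Lemma lifts_sum (A : Type) (s : seq A) (Phi : A -> (nat -> R) -> R) Psi :
  (forall i, lifts (Phi i) (Psi i)) ->
  lifts (fun t => \sum_(i <- s) Phi i t) (fun X => \sum_(i <- s) Psi i X).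
Proof.
move=> h; elim: s => [|i s IH].
  move=> X; rewrite big_nil; apply: cvgn_ext (cvg_cst (0 : R)) => J.
  by rewrite big1// => j _; rewrite big_nil.
move=> X; rewrite big_cons.
apply: cvgn_ext (@lifts_add _ _ _ _ (h i) IH X) => J.
by apply: eq_bigr => j _; rewrite big_cons.
Qed.

Lemma lifts_expect (d : R) n (Phi : (nat -> R) -> (nat -> R) -> R) Psi :
  (forall xi, lifts (Phi xi) (Psi xi)) ->
  lifts (fun t => expect d n (fun xi => Phi xi t))
        (fun X => expect d n (fun xi => Psi xi X)).
Proof. by move=> h; apply: lifts_sum => p; apply: lifts_scale. Qed.

(** The transfer principle: inequalities between combinations of r-th powers of
    absolute values of linear forms pass from the real line to ell_r. *)
Lemma lifts_le Phi1 Psi1 Phi2 Psi2 : lifts Phi1 Psi1 -> lifts Phi2 Psi2 ->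
  (forall t, Phi1 t <= Phi2 t) -> forall X, Psi1 X <= Psi2 X.
Proof.
move=> h1 h2 h12 X; apply: (ler_cvg_to (h1 X) (h2 X)).
by apply: nearW => J; apply: ler_sum => j _.
Qed.

Lemma ell_normE x : ell_norm x = pnorm x `^ r^-1.
Proof. by rewrite /pnorm powRK ?ell_norm_ge0// gt_eqF// r_gt0. Qed.

Lemma pnormZ (c : R) x : pnorm (c *: x) = `|c| `^ r * pnorm x.
Proof.
apply: (cvg_unique _ (@pnorm_cvg (c *: x))) => //.
apply: cvgn_ext (cvgMl_tmp (@pnorm_cvg x)) => J.
rewrite mulr_sumr; apply: eq_bigr => j _.
by rewrite coordZ normrM powRM.
Qed.

Lemma ell_normZ (c : R) x : ell_norm (c *: x) = `|c| * ell_norm x.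
Proof. by rewrite !ell_normE pnormZ powRM ?powR_ge0// powRK// gt_eqF// r_gt0. Qed.

Lemma coord_le_pnorm x j : `|coord x j| `^ r <= pnorm x.
Proof.
apply: (@ler_cvg_to _ _ _ _ (fun=> `|coord x j| `^ r) _ _ _
  (@cvg_cst _ _ _ _ _) (@pnorm_cvg x)).
exists j.+1 => // J /= jJ; rewrite (bigD1 (Ordinal jJ))//= lerDl.
by apply: sumr_ge0 => i _; exact: powR_ge0.
Qed.

Lemma ell_norm_eq0 x : ell_norm x = 0 -> x = 0.
Proof.
move=> x0; apply: coord_inj => j; have := coord_le_pnorm x j.
rewrite /pnorm x0 powR0 ?gt_eqF ?r_gt0// => h; rewrite coord0; apply/eqP.
rewrite -normr_eq0 -(powR_eq0_eq0 (x := `|coord x j|) (p := r))//.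
by apply/eqP; rewrite eq_le h powR_ge0.
Qed.

Lemma ell_norm0 : ell_norm (0 : ell) = 0.
Proof. by rewrite -(scale0r (0 : ell)) ell_normZ normr0 mul0r. Qed.

Lemma unit_coords_Lfun (j : nat) :
  (fun i : nat => (i == j)%:R : R) \in Lfun (@counting nat R) r%:E.
Proof.
have r0 := r_gt0.
have e k : (j < k)%N -> `|(k == j)%:R : R| `^ r = 0.
  by move=> jk; rewrite gtn_eqF// normr0 powR0// gt_eqF.
apply/andP; split; rewrite inE/=; first by [].
rewrite /finite_norm Lnorm_counting// poweR_lty//.
rewrite (nneseries_split 0 j.+1); last by move=> k _; exact: poweR_ge0.
rewrite add0n [X in (_ + X)%E](_ : _ = 0%E) ?adde0.
  rewrite (eq_bigr (fun k => (`|(k == j)%:R : R| `^ r)%:E))//.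
  by rewrite sumEFin ltry.
rewrite ereal_series_cond eseries0// => k _ /andP[jk _]; exact: (congr1 EFin (e k jk)).
Qed.

Definition unitv (j : nat) : ell := Lfun_Sub r1 (unit_coords_Lfun j).

Lemma coord_unitv i j : coord (unitv j) i = (i == j)%:R.
Proof. by []. Qed.

Lemma pnorm_unitv M (b : nat -> R) :
  pnorm (\sum_(j < M) b j *: unitv j) = \sum_(j < M) `|b j| `^ r.
Proof.
set x := \sum_(j < M) b j *: unitv j.
have cx j : coord x j = if (j < M)%N then b j else 0.
  rewrite coord_sum; under eq_bigr do rewrite coord_unitv.
  case: ifPn => [jM|]; last rewrite -leqNgt => Mj.
    rewrite (bigD1 (Ordinal jM))//= eqxx mulr1 big1 ?addr0// => i.
    by rewrite -val_eqE /= eq_sym => /negPf ->; rewrite mulr0.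
  by rewrite big1// => i _; rewrite gtn_eqF ?mulr0// (leq_trans _ Mj).
suff h : (fun J => \sum_(j < J) `|coord x j| `^ r) @ \oo -->
    (\sum_(j < M) `|b j| `^ r : R).
  exact: (cvg_unique (@Rhausdorff R) (@pnorm_cvg x) h).
apply: (@cvg_trans _ ((fun=> \sum_(j < M) `|b j| `^ r) @ \oo)); last exact: cvg_cst.
apply: near_eq_cvg; exists M => // J /= MJ.
rewrite (big_ord_widen J (fun j => `|b j| `^ r) MJ) big_mkcond/=.
apply: eq_bigr => j _; rewrite cx; case: ifP => // _.
by rewrite normr0 powR0// gt_eqF ?r_gt0.
Qed.

End Ell.

(** * Uniform embeddings as systems of vectors *)

Section Embed.
Context {R : realType} {r : R} {r1 : (1 <= r%:E)%E}.
Local Notation ell := (@ell R r r1).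

Definition homogeneous (NE : forall n, 'rV[R]_n -> R) :=
  forall n (c : R) (a : 'rV[R]_n), NE n (c *: a) = `|c| * NE n a.

Definition vec n (a : nat -> R) : 'rV[R]_n := \row_(i < n) a i.

(** A uniform embedding in coordinates: X_i is the image of the i-th unit vector,
    rescaled so that the inverse operator has norm at most 1. *)
Definition bounded_embeddings (NE : forall n, 'rV[R]_n -> R) :=
  exists2 D : R, 0 <= D & forall n, (0 < n)%N -> exists X : nat -> ell,
    forall a : nat -> R,
      NE n (vec n a) <= ell_norm (\sum_(i < n) a i *: X i) <= D * NE n (vec n a).

(** How a bound on the unit ball of a homogeneous function gives an inequality at
    every point. The case x = 0 is included, where the bound on the whole line
    through the point forces y <= 0. *)
Lemma homogeneous_bound (x y M : R) : 0 <= x ->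
  (forall c, 0 < c -> c * x <= 1 -> c * y <= M) -> y <= M * x.
Proof.
rewrite le_eqVlt => /predU1P[<-|x0] h; last first.
  have := h x^-1; rewrite invr_gt0 mulVf ?gt_eqF// => /(_ x0 (lexx _)).
  by rewrite mulrC ler_pdivrMr.
rewrite mulr0 leNgt; apply/negP => y0.
have M0 : 0 <= M by have := h 1 ltr01; rewrite mulr0 mul1r => /(_ ler01); lra.
have := h ((M + 1) / y); rewrite mulr0 divr_gt0 ?ltr_wpDl// => /(_ isT ler01).
by rewrite divfK ?gt_eqF//; lra.
Qed.

Lemma opnorm_bound (U V : Type) (D : set U) (NU : U -> R) (NV : V -> R)
    (f : U -> V) (M : R) x :
  (opnorm D NU NV f <= M%:E)%E -> D x -> NU x <= 1 -> NV (f x) <= M.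
Proof.
move=> fM Dx x1; rewrite -lee_fin; apply: le_trans fM.
by apply: ereal_sup_ubound; exists x.
Qed.

Lemma linear_vec_sum n (T : {linear 'rV[R]_n -> ell}) (a : nat -> R) :
  T (vec n a) = \sum_(i < n) a i *: T (delta_mx 0 i).
Proof.
rewrite [vec n a]row_sum_delta linear_sum; apply: eq_bigr => i _.
by rewrite linearZ /= mxE.
Qed.

(** Both operator norms are positive, by injectivity and because the first unit
    vector has positive norm. Hence finiteness of their product makes both finite,
    and no value 0 * oo hides an unbounded operator. *)
Lemma embeds_uniformly_vectors (NE : forall n, 'rV[R]_n -> R) :
  homogeneous NE -> (forall n a, 0 <= NE n a) ->
  (forall n, 0 < NE n.+1 (delta_mx 0 0)) ->
  embeds_uniformly NE (@ell_norm R r r1) -> bounded_embeddings NE.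
Proof.
move=> NEZ NE0 NEd [T [Tinj]].
set S := ereal_sup _ => Soo.
have [D D0 SD] : exists2 D : R, 0 <= D & (S <= D%:E)%E.
  case: S Soo => [s _||_]//.
    by exists (Num.max s 0); rewrite ?lee_fin le_max lexx ?orbT.
  by exists 0; rewrite ?leNye.
exists D => // -[//|n] _; set m := n.+1.
have dTD : (distortion (NE m) (@ell_norm R r r1) (T m) <= D%:E)%E.
  by apply: le_trans SD; apply: ereal_sup_ubound; exists m.
have injT : injective (T m) by exact: Tinj.
pose e : 'rV[R]_m := delta_mx 0 0.
have e0 : 0 < NE m e by exact: NEd.
have Te0 : 0 < ell_norm (T m e).
  rewrite lt_neqAle ell_norm_ge0 andbT eq_sym; apply/eqP => /ell_norm_eq0.
  rewrite -(raddf0 (T m)) => /injT e_0.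
  by move: e0; rewrite e_0 -[X in NE m X](scale0r 0) NEZ normr0 mul0r ltxx.
have pinvT x : 'pinv_(fun=> 0) setT (T m) (T m x) = x.
  by rewrite pinvKV ?inE// => u v _ _; exact: injT.
move: dTD; rewrite /distortion.
set A := opnorm _ _ _ _; set B := opnorm _ _ _ _ => AB.
have A0 : (0 < A)%E.
  apply: (@lt_le_trans _ _ (ell_norm (T m ((NE m e)^-1 *: e)))%:E).
    by rewrite linearZ /= ell_normZ lte_fin mulr_gt0// normr_gt0 invr_eq0 gt_eqF.
  apply: ereal_sup_ubound; exists ((NE m e)^-1 *: e) => //; split => //=.
  by rewrite NEZ gtr0_norm ?invr_gt0// mulVf// gt_eqF.
have B0 : (0 < B)%E.
  pose c := (ell_norm (T m e))^-1.
  apply: (@lt_le_trans _ _ (NE m (c *: e))%:E).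
    by rewrite NEZ lte_fin mulr_gt0// normr_gt0 invr_eq0 gt_eqF.
  apply: ereal_sup_ubound; exists (T m (c *: e)); last by rewrite pinvT.
  split; first by exists (c *: e).
  by rewrite /= linearZ /= ell_normZ gtr0_norm ?invr_gt0// mulVf// gt_eqF.
(* a positive factor times +oo is +oo, so neither norm is infinite *)
have [[M2 AM] [M1 BM]] : (exists M, A = M%:E) /\ (exists M, B = M%:E).
  move: AB A0 B0; case: A => [M2||//]; case: B => [M1||//].
  - by move=> _ _ _; split; [exists M2|exists M1].
  - by rewrite lte_fin => + M20; rewrite gt0_muley ?lte_fin// leye_eq.
  - by move=> + _; rewrite lte_fin => + M10; rewrite gt0_mulye ?lte_fin// leye_eq.
  - by rewrite mulyy leye_eq.
move: A0 B0 AB; rewrite AM BM !lte_fin -EFinM lee_fin => M20 M10 M12.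
exists (fun i => M1 *: T m (delta_mx 0 (inord i))) => a.
have -> : \sum_(i < m) a i *: (M1 *: T m (delta_mx 0 (inord i))) =
    M1 *: T m (vec m a).
  rewrite linear_vec_sum scaler_sumr; apply: eq_bigr => i _.
  by rewrite inord_val !scalerA mulrC.
set v := vec m a; rewrite ell_normZ gtr0_norm//; apply/andP; split.
  apply: (homogeneous_bound (ell_norm_ge0 _)).
  move=> c c0 cv; rewrite -[c]gtr0_norm// -NEZ -[c *: v]pinvT.
  apply: (@opnorm_bound _ _ (range (T m)) (@ell_norm R r r1)) => //.
  - by rewrite -/B BM.
  - by rewrite linearZ /= ell_normZ gtr0_norm.
apply: (@le_trans _ _ (M1 * (M2 * NE m v))).
  rewrite ler_pM2l//; apply: (homogeneous_bound (NE0 _ _)) => c c0 cv.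
  rewrite -[c]gtr0_norm// -ell_normZ -linearZ.
  apply: (@opnorm_bound _ _ setT (NE m)) => //.
  - by rewrite -/A AM.
  - by rewrite NEZ gtr0_norm.
by rewrite mulrA ler_wpM2r// mulrC.
Qed.

Lemma vectors_embed_uniformly (NE : forall n, 'rV[R]_n -> R) :
  (forall n a, 0 <= NE n a) -> (forall n a, NE n a = 0 -> a = 0) ->
  bounded_embeddings NE -> embeds_uniformly NE (@ell_norm R r r1).
Proof.
move=> NE0 NE00 [D D0 h].
have ex n : exists T : {linear 'rV[R]_n -> ell}, (0 < n)%N ->
    forall a, NE n a <= ell_norm (T a) <= D * NE n a.
  case: n => [|n]; first by exists \0.
  have [X hX] := h n.+1 isT.
  pose T (a : 'rV[R]_n.+1) : ell := \sum_(i < n.+1) a 0 i *: X i.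
  have Tlin : linear T.
    move=> c a b; rewrite /T scaler_sumr -big_split; apply: eq_bigr => i _ /=.
    by rewrite !mxE scalerDl scalerA.
  pose TL := GRing.isLinear.Build _ _ _ _ T Tlin.
  exists (HB.pack_for {linear 'rV[R]_n.+1 -> ell} T TL) => _ a.
  have := hX (fun i => a 0 (inord i)).
  have -> : vec n.+1 (fun i => a 0 (inord i)) = a.
    by apply/rowP => i; rewrite mxE inord_val.
  by under eq_bigr do rewrite inord_val.
pose T n := sval (cid (ex n)); have hT n := svalP (cid (ex n)).
have injT n : (0 < n)%N -> injective (T n).
  move=> n0 a b; move/eqP; rewrite -subr_eq0 -raddfB => /eqP Tab.
  apply/eqP; rewrite -subr_eq0; apply/eqP/NE00/eqP; rewrite eq_le NE0 andbT.
  by have /andP[+ _] := hT n n0 (a - b); rewrite -/(T n) Tab ell_norm0.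
exists T; split => //.
apply: (@le_lt_trans _ _ D%:E); last exact: ltry.
apply: ge_ereal_sup => _ [n n0 <-]; rewrite /distortion -[leRHS]mule1.
have pinvT x : 'pinv_(fun=> 0) setT (T n) (T n x) = x.
  by rewrite pinvKV ?inE// => u v _ _; exact: injT.
have NEn0 : NE n 0 = 0.
  apply/eqP; rewrite eq_le NE0 andbT.
  by have /andP[+ _] := hT n n0 0; rewrite raddf0 ell_norm0.
apply: lee_pmul.
- apply: ereal_sup_ubound; exists 0; first by rewrite /= NEn0 ler01.
  by rewrite raddf0 ell_norm0.
- apply: ereal_sup_ubound; exists (T n 0); last by rewrite pinvT NEn0.
  by split; [exists 0|rewrite /= raddf0 ell_norm0 ler01].
- apply: ge_ereal_sup => _ [a [_ /= a1] <-]; rewrite lee_fin.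
  have /andP[_ /le_trans] := hT n n0 a; apply.
  by rewrite -[leRHS]mulr1 ler_wpM2l.
- apply: ge_ereal_sup => _ [y [[a _ <-] /= a1] <-]; rewrite lee_fin pinvT.
  by have /andP[/le_trans + _] := hT n n0 a; apply.
Qed.

End Embed.

(** * Averages of norms in ell_r *)

Section ScalarMore.
Context {R : realType}.
Implicit Types (t a : nat -> R) (r : R).

(** The power mean inequality between the exponents r and 2. *)
Lemma sumpow_le_sumsq n t r : (0 < n)%N -> 0 < r -> r <= 2 ->
  n%:R `^ (r / 2 - 1) * sumpow n t r <= sumsq n t `^ (r / 2).
Proof.
move=> n0 r0 r2; have n0' : 0 < n%:R :> R by rewrite ltr0n.
have p1 : 1 <= 2 / r by rewrite ler_pdivlMr// mul1r.
have w1 : \sum_(i < n) (n%:R^-1 : R) = 1.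
  by rewrite sumr_const card_ord -[_ *+ n]mulr_natr mulVf// gt_eqF.
have w0 (i : nat) : 0 <= n%:R^-1 :> R by rewrite invr_ge0 ltW.
have := @jensen_sum R n _ (fun i => `|t i| `^ r) (2 / r) w0 w1 p1
  (fun=> powR_ge0 _ _).
rewrite -!mulr_sumr -/(sumpow n t r).
have -> : \sum_(i < n) (`|t i| `^ r) `^ (2 / r) = sumsq n t.
  apply: eq_bigr => i _; rewrite -powRrM (_ : r * (2 / r) = 2).
    by rewrite powR_mulrn// real_normK ?num_real.
  by field; rewrite gt_eqF.
have S0 := sumpow_ge0 n t r; have B0 := sumsq_ge0 n t.
move/(ler_powR2 (p := r / 2) (divr_ge0 (ltW r0) (ler0n R 2)) (powR_ge0 _ _)).
rewrite -powRrM (_ : 2 / r * (r / 2) = 1); last by field; rewrite gt_eqF.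
rewrite powRr1 ?mulr_ge0 ?invr_ge0 ?(ltW n0')//.
rewrite powRM ?invr_ge0 ?(ltW n0')// powR_inv ?(ltW n0')//.
rewrite ler_pdivlMl ?powR_gt0// => h.
by rewrite powRB ?(gt_eqF n0') ?implybT// powRr1 ?(ltW n0')// -mulrA.
Qed.

(** Jensen's inequality with weights a_i^2 / sumsq a. It replaces the triangle
    inequality of ell_(r/2) in the proof that ell_r has type 2. *)
Lemma sumsq_weighted_le n a t r : 2 <= r ->
  sumsq n (fun i => a i * t i) `^ (r / 2) <=
  sumsq n a `^ (r / 2 - 1) * \sum_(i < n) a i ^+ 2 * `|t i| `^ r.
Proof.
move=> r2; have r0 : 0 < r by rewrite (lt_le_trans _ r2).
have S0 : 0 <= \sum_(i < n) a i ^+ 2 * `|t i| `^ r.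
  by apply: sumr_ge0 => i _; rewrite mulr_ge0 ?sqr_ge0 ?powR_ge0.
have := sumsq_ge0 n a; rewrite le_eqVlt => /predU1P[A0|A0].
  have az (i : 'I_n) : a i = 0.
    apply/eqP; rewrite -sqrf_eq0; move/esym/eqP: A0.
    rewrite psumr_eq0; last by move=> j _; exact: sqr_ge0.
    by move/allP/(_ i); rewrite mem_index_enum; apply.
  rewrite [sumsq n (fun i => _)]big1 ?powR0 ?mulr_ge0 ?powR_ge0//.
    by rewrite mulf_neq0 ?invr_eq0 ?gt_eqF.
  by move=> i _; rewrite az mul0r expr0n.
set A := sumsq n a in A0 *.
have p1 : 1 <= r / 2 by rewrite ler_pdivlMr// mul1r.
have w0 (i : nat) : 0 <= a i ^+ 2 / A by rewrite divr_ge0 ?sqr_ge0// ltW.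
have w1 : \sum_(i < n) a i ^+ 2 / A = 1 by rewrite -mulr_suml divff// gt_eqF.
have := jensen_sum w0 w1 p1 (fun i => sqr_ge0 (t i)).
have -> : \sum_(i < n) a i ^+ 2 / A * t i ^+ 2 =
    A^-1 * sumsq n (fun i => a i * t i).
  by rewrite mulr_sumr; apply: eq_bigr => i _; rewrite exprMn; ring.
have -> : \sum_(i < n) a i ^+ 2 / A * (t i ^+ 2) `^ (r / 2) =
    A^-1 * \sum_(i < n) a i ^+ 2 * `|t i| `^ r.
  by rewrite mulr_sumr; apply: eq_bigr => i _; rewrite sqr_powR; ring.
rewrite powRM ?invr_ge0 ?(ltW A0) ?sumsq_ge0//.
rewrite powR_inv ?(ltW A0)// ler_pdivrMl ?powR_gt0//.
rewrite powRB ?(gt_eqF A0) ?implybT// powRr1 ?(ltW A0)//.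
by rewrite !mulrA.
Qed.

Lemma expect_count (d : R) n :
  expect d n (fun xi => \sum_(i < n) `|xi i|) = d * n%:R.
Proof.
elim: n => [|n IH]; first by rewrite expect0 big_ord0 mulr0.
rewrite expectS (eq_expect _ _ (g2 := fun xi => 1 * (\sum_(i < n) `|xi i|) + d)).
  by rewrite expect_affine IH -natr1; ring.
move=> xi; rewrite /average_last !big_ord_recr/= /set_coef eqxx normr0 normr1 normrN1.
have e c : \sum_(i < n) `|if (i : nat) == n then c else xi i| = \sum_(i < n) `|xi i|.
  by apply: eq_bigr => i _; rewrite ltn_eqF.
by rewrite !e; field.
Qed.

End ScalarMore.

Section Vectors.
Context {R : realType} {r : R} {r1 : (1 <= r%:E)%E}.
Local Notation ell := (@ell R r r1).
Implicit Types X : nat -> ell.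

Definition avg (d : R) n X : R :=
  expect d n (fun xi => pnorm (\sum_(i < n) xi i *: X i)).

Lemma lifts_avg d n :
  lifts (fun t => expect d n (fun xi => `|walk n t xi| `^ r)) (avg d n).
Proof. by apply: lifts_expect => xi; exact: lifts_pnorm. Qed.

Lemma lifts_coord i : lifts (fun t => `|t i| `^ r) (fun X => pnorm (X i)).
Proof. by move=> X; exact: pnorm_cvg. Qed.

Lemma lifts_sumpow n :
  lifts (fun t => sumpow n t r) (fun X => \sum_(i < n) pnorm (X i)).
Proof. by apply: lifts_sum => i; exact: lifts_coord. Qed.

(** ell_r has type r for r <= 2. *)
Lemma avg_le_sum n X : r <= 2 -> avg 1 n X <= \sum_(i < n) pnorm (X i).
Proof.
move=> r2; move: X; apply: (lifts_le (@lifts_avg _ _) (@lifts_sumpow _)) => t.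
by apply: expect_walk_le_sumpow => //; exact: (r_gt0 (r1 := r1)).
Qed.

(** ell_r has cotype r for r >= 2. *)
Lemma avg_ge_sum n X : 2 <= r -> \sum_(i < n) pnorm (X i) <= avg 1 n X.
Proof.
move=> r2; move: X; apply: (lifts_le (@lifts_sumpow _) (@lifts_avg _ _)) => t.
exact: expect_walk_ge_sumpow.
Qed.

(** What cotype 2 of ell_r for r <= 2 says about n vectors of about equal norms. *)
Lemma avg_ge_sum_small n X : (0 < n)%N -> r <= 2 ->
  n%:R `^ (r / 2 - 1) / 4 * \sum_(i < n) pnorm (X i) <= avg 1 n X.
Proof.
move=> n0 r2; move: X.
apply: (lifts_le (lifts_scale (@lifts_sumpow _)) (@lifts_avg _ _)) => t.
have r0 := r_gt0 (r1 := r1).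
apply: le_trans (expect_walk_ge_small n t r0 r2).
by rewrite mulrAC ler_wpM2r// sumpow_le_sumsq.
Qed.

(** What type 2 of ell_r for r > 2 says about multiples of n vectors of about equal
    norms. *)
Lemma avg_le_weighted n (a : nat -> R) X : 2 < r ->
  avg 1 n (fun i => a i *: X i) <=
  2 * rosenthal_const r * (sumsq n a `^ (r / 2 - 1) *
    \sum_(i < n) a i ^+ 2 * pnorm (X i)).
Proof.
move=> r2; rewrite /avg.
under eq_expect do under eq_bigr do rewrite scalerA.
move: X; apply: lifts_le.
- by apply: lifts_expect => xi; exact: (@lifts_pnorm _ _ _ n (fun i => xi i * a i)).
- do 2 apply: lifts_scale; apply: lifts_sum => i.
  by apply: lifts_scale; exact: lifts_coord.
move=> t; apply: le_trans (_ : _ <= 2 * rosenthal_const r *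
    sumsq n (fun i => a i * t i) `^ (r / 2)) _.
  rewrite (eq_expect _ _ (g2 := fun xi => `|walk n (fun i => a i * t i) xi| `^ r)).
    exact: khintchine_upper.
  by move=> xi; congr (`| _ | `^ _); apply: eq_bigr => i _; rewrite mulrA.
rewrite ler_wpM2l ?mulr_ge0 ?rosenthal_const_ge0//.
by rewrite sumsq_weighted_le// ltW.
Qed.

(** The average over random subsets is controlled by single vectors and by the
    average over the full set. Hence it cannot grow with d like the power
    (d n)^(r/s) for an exponent s strictly between 2 and r. *)
Lemma avg_rosenthal d n X : 0 <= d <= 1 -> 2 < r ->
  avg d n X <= rosenthal_const r *
    (d * (\sum_(i < n) pnorm (X i)) + d `^ (r / 2) * avg 1 n X).
Proof.
move=> d01 r2; move: X; apply: (lifts_le (@lifts_avg _ _)).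
  apply: lifts_scale; apply: lifts_add.
    by apply: lifts_scale; exact: lifts_sumpow.
  by apply: lifts_scale; exact: lifts_avg.
move=> t; apply: (le_trans (rosenthal n t d01 r2)).
rewrite ler_wpM2l ?rosenthal_const_ge0// lerD2l powRM ?sumsq_ge0//; last first.
  by case/andP: d01.
by rewrite ler_wpM2l ?powR_ge0// expect_walk_ge// ltW.
Qed.

End Vectors.

(** * Norms that are a power on vectors with entries 0, 1 and -1 *)

Section Flat.
Context {R : realType} {r : R} {r1 : (1 <= r%:E)%E}.
Local Notation ell := (@ell R r r1).

Definition flat n (xi : nat -> R) :=
  forall i, (i < n)%N -> `|xi i| = 1 \/ xi i = 0.

(** The norm of a vector with m entries 1 or -1 and no other nonzero entry is
    m^(1/s). The norm of ell_s and all Lorentz norms of exponent s have this property,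
    and nothing more about them enters the non-embedding results for s <> 2. *)
Definition power_on_flat (s : R) (NE : forall n, 'rV[R]_n -> R) :=
  forall n xi, flat n xi -> NE n (vec n xi) = (\sum_(i < n) `|xi i|) `^ s^-1.

Lemma bounded_embeddings_pnorm (NE : forall n, 'rV[R]_n -> R) :
  (forall n a, 0 <= NE n a) -> @bounded_embeddings R r r1 NE ->
  exists2 M : R, 0 <= M & forall n, (0 < n)%N -> exists X : nat -> ell,
    forall a : nat -> R,
      NE n (vec n a) `^ r <= pnorm (\sum_(i < n) a i *: X i) <=
      M * NE n (vec n a) `^ r.
Proof.
move=> NE0 [D D0 h]; exists (D `^ r); first exact: powR_ge0.
move=> n /h[X hX]; exists X => a; have /andP[l u] := hX a.
have r0 : 0 <= r by apply: ltW; exact: (r_gt0 (r1 := r1)).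
by rewrite -powRM// !ler_powR2// ell_norm_ge0.
Qed.

Definition signs n (xi : nat -> R) := forall i, (i < n)%N -> `|xi i| = 1.

Lemma signs_flat n xi : signs n xi -> flat n xi.
Proof. by move=> hx i /hx; left. Qed.

Lemma sum_abs_signs n xi : signs n xi -> \sum_(i < n) `|xi i| = n%:R.
Proof.
move=> hx; rewrite -[in RHS](card_ord n) -sumr_const.
by apply: eq_bigr => i _; exact: hx.
Qed.

Lemma le_expect_signs n g1 g2 : (forall xi, signs n xi -> g1 xi <= g2 xi) ->
  expect 1 n g1 <= expect 1 n g2.
Proof.
move=> g12; apply: le_expect_supp => [|xi hx]; first by rewrite ler01 lexx.
by apply: g12 => i /hx[//|[]]; rewrite ltxx.
Qed.

(** A family that embeds has images X_i of comparable norms, sign averages of order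
    n^(r/s), and selector averages at least (d n)^(r/s), by Jensen's inequality for
    the number of selected indices. *)
Lemma flat_bounds (NE : forall n, 'rV[R]_n -> R) s M n (X : nat -> ell) :
  power_on_flat s NE ->
  (forall a : nat -> R, NE n (vec n a) `^ r <=
     pnorm (\sum_(i < n) a i *: X i) <= M * NE n (vec n a) `^ r) ->
  [/\ forall i, (i < n)%N -> 1 <= pnorm (X i) <= M,
      n%:R `^ (r / s) <= avg 1 n X <= M * n%:R `^ (r / s) &
      forall d, 0 <= d <= 1 -> 1 <= r / s -> (d * n%:R) `^ (r / s) <= avg d n X].
Proof.
move=> NEs hX.
have hflat xi : flat n xi ->
    (\sum_(i < n) `|xi i|) `^ (r / s) <= pnorm (\sum_(i < n) xi i *: X i) <=
    M * (\sum_(i < n) `|xi i|) `^ (r / s).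
  by move=> fx; have := hX xi; rewrite NEs// -powRrM mulrC.
split.
- move=> i ni; pose xi (j : nat) : R := (j == i)%:R.
  have fx : flat n xi.
    by move=> j _; rewrite /xi; case: eqP; [left; rewrite normr1|right].
  have := hflat xi fx.
  have -> : \sum_(j < n) `|xi j| = 1.
    rewrite (bigD1 (Ordinal ni))//= /xi eqxx normr1 big1 ?addr0// => j.
    by rewrite -val_eqE /= => /negPf ->; rewrite normr0.
  have -> : \sum_(j < n) xi j *: X j = X i.
    rewrite (bigD1 (Ordinal ni))//= /xi eqxx scale1r big1 ?addr0// => j.
    by rewrite -val_eqE /= => /negPf ->; rewrite scale0r.
  by rewrite powR1 mulr1.
- apply/andP; split.
    rewrite -[leLHS](expect_cst 1 n); apply: le_expect_signs => xi hx.
    by have /andP[+ _] := hflat xi (signs_flat hx); rewrite sum_abs_signs.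
  rewrite -[leRHS](expect_cst 1 n); apply: le_expect_signs => xi hx.
  by have /andP[_] := hflat xi (signs_flat hx); rewrite sum_abs_signs.
- move=> d d01 rs1; rewrite -expect_count.
  apply: (le_trans (jensen_expect n d01 rs1 _)).
    by move=> xi; exact: sumr_ge0.
  apply: le_expect_supp => // xi hx.
  suff /hflat/andP[] : flat n xi by [].
  by move=> i /hx[|[_]]; [left|right].
Qed.

(** The size n^(r/s) of the sign averages contradicts, for large n, the type of
    ell_r when s < min (2, r) and its cotype when s > max (2, r). If 2 < s < r, type
    and cotype leave room, and one looks at random subsets of size about n^(1/2). *)
Lemma no_flat_embedding (NE : forall n, 'rV[R]_n -> R) s :
  (forall n a, 0 <= NE n a) -> power_on_flat s NE -> 0 < s -> s <> 2 ->
  (s < Num.min 2 r) \/ (Num.max 2 r < s) \/ (2 < r /\ s <> r) ->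
  ~ @bounded_embeddings R r r1 NE.
Proof.
move=> NE0 NEs s0 s2 hs /(bounded_embeddings_pnorm NE0)[M M0 h0].
have h n : (0 < n)%N -> exists X : nat -> ell,
    [/\ n%:R <= \sum_(i < n) pnorm (X i) <= M * n%:R,
        n%:R `^ (r / s) <= avg 1 n X <= M * n%:R `^ (r / s) &
        forall d, 0 <= d <= 1 -> 1 <= r / s ->
          (d * n%:R) `^ (r / s) <= avg d n X].
  move=> /h0[X /(flat_bounds NEs)[h1 hmean hsel]]; exists X; split => //.
  have -> : n%:R = \sum_(i < n) (1 : R) by rewrite sumr_const card_ord.
  rewrite mulr_sumr; apply/andP; split; apply: ler_sum => i _;
    by rewrite ?mulr1; case/andP: (h1 i (ltn_ord i)).
have r0 : 0 < r := r_gt0 (r1 := r1).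
have [r2|r2] := leP r 2; have [sr|rs] := ltP s r.
- (* s < r <= 2: type r bounds the average by a multiple of n *)
  apply: (@no_powR_bound R 1 (r / s) M); first by rewrite ltr_pdivlMr ?mul1r.
  move=> n n0; have [X [/andP[_ hsum] /andP[l _] _]] := h n n0.
  rewrite powRr1//; apply: (le_trans l); apply: le_trans hsum.
  exact: avg_le_sum.
- (* r <= 2 < s: cotype 2 forces the average to be at least of order n^(r/2) *)
  have s2' : 2 < s.
    case: hs => [|[|[]]]; first by rewrite lt_min => /andP[_ /lt_geF]; rewrite rs.
      by rewrite gt_max => /andP[].
    by rewrite ltNge r2.
  apply: (@no_powR_bound R (r / s) (r / 2) (4 * M)).
    by rewrite ltr_pM2l// ltf_pV2 ?posrE//.
  move=> n n0; have [X [/andP[hsum _] /andP[_ u] _]] := h n n0.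
  have := avg_ge_sum_small X n0 r2.
  have n0' : 0 < n%:R :> R by rewrite ltr0n.
  move=> /le_trans/(_ u).
  have : n%:R `^ (r / 2) / 4 <=
      n%:R `^ (r / 2 - 1) / 4 * \sum_(i < n) pnorm (X i).
    rewrite -{1}(subrK 1 (r / 2)) powRD ?(gt_eqF n0') ?implybT//.
    by rewrite mulrAC powRr1// ler_wpM2l// divr_ge0 ?powR_ge0.
  move=> /le_trans/[apply]; lra.
- have [s2'|s2'] := ltP s 2.
  + (* s < 2 < r: type 2 bounds the average by a multiple of n^(r/2) *)
    apply: (@no_powR_bound R (r / 2) (r / s) (2 * rosenthal_const r * M)).
      by rewrite ltr_pM2l// ltf_pV2 ?posrE//.
    move=> n n0; have [X [/andP[_ hsum] /andP[l _] _]] := h n n0.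
    apply: (le_trans l).
    have := avg_le_weighted n (fun=> 1) X r2.
    have -> : avg 1 n (fun i => 1 *: X i) = avg 1 n X.
      by apply: eq_expect => xi; under eq_bigr do rewrite scale1r.
    move/le_trans; apply; rewrite -[leRHS]mulrA.
    rewrite ler_wpM2l ?mulr_ge0 ?rosenthal_const_ge0//.
    have -> : sumsq n (fun=> 1) = n%:R :> R.
      by rewrite /sumsq; under eq_bigr do rewrite expr1n; rewrite sumr_const card_ord.
    under eq_bigr do rewrite expr1n mul1r.
    have n0' : 0 < n%:R :> R by rewrite ltr0n.
    rewrite -[X in _ <= _ * X](mulr_powRB1 (ltW n0') (divr_gt0 r0 (ltr0Sn R 1))).
    by rewrite mulrA mulrC ler_wpM2r ?powR_ge0.
  + (* 2 < s < r: with d = n^(-1/2), about n^(1/2) vectors are selected and their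
       average is at least n^(r/(2s)). Rosenthal's bound is of order
       n^(1/2) + n^(r/s - r/4), and both exponents are smaller than r/(2s). *)
    have {s2 s2'}s2 : 2 < s by rewrite lt_neqAle s2' andbT eq_sym; apply/eqP.
    pose a := Num.max 2^-1 (r / s - r / 4).
    have ab : a < r / (2 * s).
      rewrite gt_max; apply/andP; split.
        by rewrite invfM mulrCA ltr_pMr ?invr_gt0// ltr_pdivlMr// mul1r.
      have : r / s < r / 2 by rewrite ltr_pM2l// ltf_pV2 ?posrE//.
      rewrite (_ : r / (2 * s) = r / s / 2); last by field; rewrite gt_eqF.
      lra.
    apply: (@no_powR_bound R _ _ (2 * rosenthal_const r * M) ab) => n n0.
    have [X [/andP[_ hsum] /andP[_ u] low]] := h n n0.
    have n0' : 0 < n%:R :> R by rewrite ltr0n.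
    have n1' : 1 <= n%:R :> R by rewrite ler1n.
    pose d : R := n%:R `^ (- 2^-1).
    have d01 : 0 <= d <= 1.
      by rewrite powR_ge0 /= -[leRHS](powRr0 n%:R) ler_powR//.
    have dn : d * n%:R = n%:R `^ 2^-1.
      rewrite /d -[X in _ * X](powRr1 (ltW n0')) -powRD ?(gt_eqF n0') ?implybT//.
      by congr (_ `^ _); field.
    have rs1 : 1 <= r / s by rewrite ler_pdivlMr// mul1r ltW.
    have := low d d01 rs1; rewrite dn -powRrM.
    rewrite (_ : 2^-1 * (r / s) = r / (2 * s)); last by field; rewrite gt_eqF.
    move/le_trans; apply; apply: (le_trans (avg_rosenthal n X d01 r2)).
    rewrite (_ : 2 * rosenthal_const r * M * n%:R `^ a = rosenthal_const r *
      (M * n%:R `^ a + M * n%:R `^ a)); last by ring.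
    rewrite ler_wpM2l ?rosenthal_const_ge0//.
    have t1 : d * (\sum_(i < n) pnorm (X i)) <= M * n%:R `^ a.
      apply: (@le_trans _ _ (d * (M * n%:R))).
        by rewrite ler_wpM2l// powR_ge0.
      rewrite mulrCA dn ler_wpM2l// ler_powR//.
      by rewrite le_max lexx.
    have t2 : d `^ (r / 2) * avg 1 n X <= M * n%:R `^ a.
      apply: (@le_trans _ _ (d `^ (r / 2) * (M * n%:R `^ (r / s)))).
        by rewrite ler_wpM2l// powR_ge0.
      rewrite mulrCA ler_wpM2l// -powRrM -powRD ?(gt_eqF n0') ?implybT//.
      rewrite ler_powR// le_max.
      rewrite (_ : - 2^-1 * (r / 2) + r / s = r / s - r / 4) ?lexx ?orbT//.
      by field; rewrite gt_eqF.
    exact: lerD.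
- (* 2 < r < s: cotype r forces the average to be at least of order n *)
  have {rs}rs : r < s.
    rewrite lt_neqAle rs andbT; case: hs => [|[|[_ /eqP]]].
    - by rewrite lt_min => /andP[_ /lt_geF]; rewrite rs.
    - by rewrite gt_max => /andP[_ /lt_eqF ->].
    - by rewrite eq_sym.
  apply: (@no_powR_bound R (r / s) 1 M); first by rewrite ltr_pdivrMr ?mul1r.
  move=> n n0; have [X [/andP[hsum _] /andP[_ u] _]] := h n n0.
  rewrite powRr1//; apply: (le_trans hsum); apply: le_trans u.
  by apply: avg_ge_sum; exact: ltW.
Qed.

End Flat.

(** * The norms of ell_s and of the Lorentz spaces *)

Section Norms.
Context {R : realType}.
Implicit Types s q : R.

Lemma lnorm_ge0 s n (a : 'rV[R]_n) : 0 <= lnorm s a.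
Proof. exact: powR_ge0. Qed.

Lemma lnorm_homogeneous s : 0 < s -> homogeneous (lnorm s).
Proof.
move=> s0 n c a; rewrite /lnorm.
under eq_bigr do rewrite mxE normrM powRM//.
rewrite -mulr_sumr powRM ?powR_ge0//; last first.
  by apply: sumr_ge0 => i _; exact: powR_ge0.
by rewrite powRK// gt_eqF.
Qed.

Lemma lnorm_eq0 s n (a : 'rV[R]_n) : 0 < s -> lnorm s a = 0 -> a = 0.
Proof.
move=> s0 /powR_eq0_eq0/eqP; rewrite psumr_eq0; last first.
  by move=> i _; exact: powR_ge0.
move=> /allP h; apply/rowP => i; rewrite mxE; apply/eqP; rewrite -normr_eq0.
by have := h i; rewrite mem_index_enum => /(_ isT); rewrite powR_eq0 => /andP[].
Qed.

Lemma lnorm_flat s : 0 < s -> power_on_flat s (lnorm s).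
Proof.
move=> s0 n xi fx; rewrite /lnorm; congr (_ `^ _); apply: eq_bigr => i _.
rewrite mxE; have [->|->] := fx i (ltn_ord i); first by rewrite powR1.
by rewrite normr0 powR0// gt_eqF.
Qed.

Lemma power_on_flat_delta s (NE : forall n, 'rV[R]_n -> R) n :
  power_on_flat s NE -> NE n.+1 (delta_mx 0 0) = 1.
Proof.
move=> NEs; pose xi (i : nat) : R := (i == 0%N)%:R.
have -> : delta_mx 0 0 = vec n.+1 xi by apply/rowP => i; rewrite !mxE.
rewrite NEs; last first.
  by move=> i _; rewrite /xi; case: eqP; [left; rewrite normr1|right].
by rewrite big_ord_recl /= normr1 big1 ?addr0 ?powR1// => i _; rewrite normr0.
Qed.

Definition absvals n (a : 'rV[R]_n) : seq R := [seq `|a 0 i| | i <- enum 'I_n].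

Lemma size_absvals n (a : 'rV[R]_n) : size (absvals a) = n.
Proof. by rewrite size_map size_enum_ord. Qed.

Lemma nth_absvals_vec n (a : nat -> R) k : (k < n)%N ->
  nth 0 (absvals (vec n a)) k = `|a k|.
Proof.
move=> kn; rewrite (nth_map (Ordinal kn)) ?size_enum_ord// mxE.
by rewrite nth_enum_ord.
Qed.

(** A decreasing list is determined by its multiset of entries, so the rearrangement
    can be read off from any decreasing list with the right entries. *)
Lemma decr_rearr_sorted n (a : 'rV[R]_n) (l : seq R) k :
  sorted >=%R l -> perm_eq l (absvals a) -> decr_rearr a k = nth 0 l k.
Proof.
move=> sl pl; rewrite /decr_rearr -/(absvals a); congr (nth 0 _ k).
apply: (sorted_eq ge_trans ge_anti (sort_sorted ge_total _) sl).
by rewrite perm_sort perm_sym.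
Qed.

Lemma decr_rearr_perm n (a b : 'rV[R]_n) k :
  perm_eq (absvals a) (absvals b) -> decr_rearr a k = decr_rearr b k.
Proof.
move=> ab; apply: decr_rearr_sorted; first exact: (sort_sorted ge_total).
by rewrite perm_sort perm_sym.
Qed.

Lemma decr_rearrZ n (c : R) (a : 'rV[R]_n) k :
  decr_rearr (c *: a) k = `|c| * decr_rearr a k.
Proof.
have -> : `|c| * decr_rearr a k =
    nth 0 [seq `|c| * x | x <- sort >=%R (absvals a)] k.
  have [kn|nk] := ltnP k (size (sort >=%R (absvals a))).
    by rewrite (nth_map 0).
  by rewrite nth_default ?size_map// /decr_rearr nth_default ?mulr0.
apply: decr_rearr_sorted.
  apply: (homo_sorted (e := >=%R)); last exact: (sort_sorted ge_total).
  by move=> x y xy; rewrite /= ler_wpM2l.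
rewrite (perm_trans (perm_map _ (permEl (perm_sort _ _))))//.
rewrite /absvals -map_comp; apply/permP => p; rewrite !count_map.
by apply: eq_count => i /=; rewrite mxE normrM.
Qed.

Lemma lorentz_ge0 s q n (a : 'rV[R]_n) : 0 <= lorentz_norm s q a.
Proof. exact: powR_ge0. Qed.

Lemma decr_rearr_ge0 n (a : 'rV[R]_n) k : 0 <= decr_rearr a k.
Proof.
have [kn|nk] := ltnP k (size (sort >=%R (absvals a))); last first.
  by rewrite /decr_rearr nth_default.
have : decr_rearr a k \in absvals a.
  by rewrite -(mem_sort >=%R) mem_nth.
by move=> /mapP[i _ ->].
Qed.

Lemma weight_ge0 p k : 0 <= p -> 0 <= k.+1%:R `^ p - k%:R `^ p :> R.
Proof. by move=> p0; rewrite subr_ge0 ler_powR2 ?ler0n// ler_nat. Qed.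

Lemma lorentz_homogeneous s q : 0 < s -> 0 < q ->
  homogeneous (lorentz_norm s q).
Proof.
move=> s0 q0 n c a; rewrite /lorentz_norm.
under eq_bigr do rewrite decr_rearrZ powRM ?decr_rearr_ge0// -mulrA.
rewrite -mulr_sumr powRM ?powR_ge0//; last first.
  apply: sumr_ge0 => i _; rewrite mulr_ge0 ?powR_ge0// weight_ge0//.
  by rewrite divr_ge0 ?ltW.
by rewrite powRK// gt_eqF.
Qed.

Lemma absvals_flat n (xi : nat -> R) : flat n xi ->
  exists2 m, (m <= n)%N & perm_eq (nseq m 1 ++ nseq (n - m) 0) (absvals (vec n xi))
    /\ \sum_(i < n) `|xi i| = m%:R.
Proof.
move=> fx; set l := absvals _.
have l01 x : x \in l -> (x == 1) || (x == 0).
  move=> /mapP[i _ ->]; rewrite mxE.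
  by have [->|->] := fx i (ltn_ord i); rewrite ?normr0 eqxx ?orbT.
pose l1 := [seq x <- l | x == 1]; pose l0 := [seq x <- l | x != 1].
have sl : (size l1 + size l0 = n)%N.
  by rewrite !size_filter count_predC size_absvals.
have e1 : l1 = nseq (size l1) 1 by apply/all_pred1P; rewrite filter_all.
have e0 : l0 = nseq (size l0) 0.
  apply/all_pred1P/allP => x; rewrite mem_filter => /andP[x1 /l01].
  by rewrite (negPf x1).
have ln : perm_eq (l1 ++ l0) l by rewrite perm_filterC.
exists (size l1); first by rewrite -sl leq_addr.
have sl0 : (n - size l1 = size l0)%N by rewrite -{1}sl addKn.
split; first by rewrite sl0 -e1 -e0.
transitivity (\sum_(x <- l) x).
  rewrite /l /absvals big_map big_enum; apply: eq_bigr => i _.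
  by rewrite mxE.
rewrite -(perm_big _ ln) big_cat/= {1}e1 {1}e0 !big_nseq !iter_addr_0.
by rewrite mul0rn addr0.
Qed.

Lemma sorted_nseq m (x : R) : sorted >=%R (nseq m x).
Proof. by case: m => //; elim=> //= m ->; rewrite lexx. Qed.

(** The m leading weights k^(q/s) - (k-1)^(q/s) telescope to m^(q/s). *)
Lemma lorentz_flat s q : 0 < s -> 0 < q -> power_on_flat s (lorentz_norm s q).
Proof.
move=> s0 q0 n xi /absvals_flat[m mn [lm ->]].
rewrite /lorentz_norm.
have qs0 : 0 < q / s by rewrite divr_gt0.
have d k : decr_rearr (vec n xi) k = (k < m)%:R.
  rewrite (decr_rearr_sorted _ _ lm).
    rewrite nth_cat size_nseq; case: ltnP => km; first by rewrite nth_nseq km.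
    by rewrite nth_nseq if_same.
  rewrite (sorted_pairwise ge_trans) pairwise_cat; apply/and3P; split.
  - by apply/allrelP => x y /nseqP[-> _] /nseqP[-> _]; exact: ler01.
  - by rewrite -(sorted_pairwise ge_trans) sorted_nseq.
  - by rewrite -(sorted_pairwise ge_trans) sorted_nseq.
transitivity ((\sum_(k < m) (k.+1%:R `^ (q / s) - k%:R `^ (q / s))) `^ q^-1 : R).
  rewrite (big_ord_widen n (fun k => k.+1%:R `^ (q / s) - k%:R `^ (q / s)) mn).
  rewrite [in RHS]big_mkcond/=; congr (_ `^ _); apply: eq_bigr => k _.
  rewrite d; case: ifP => _; first by rewrite powR1 mul1r.
  by rewrite powR0 ?mul0r// gt_eqF.
rewrite -(big_mkord xpredT (fun k => k.+1%:R `^ (q / s) - k%:R `^ (q / s))).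
rewrite telescope_sumr// powR0 ?gt_eqF// subr0 -powRrM.
by congr (_ `^ _); field; rewrite !gt_eqF.
Qed.

End Norms.

(** * Lorentz spaces with first exponent 2 *)

Section Bernoulli.
Context {R : realType}.
Implicit Types p u : R.

Lemma bernoulli_ge p u : 1 <= p -> u <= 1 -> 1 - (1 - u) `^ p <= p * u.
Proof.
move=> p1 u1.
have := @powR_tangent R p (1 - u) 1 p1 _ ler01; rewrite subr_ge0 => /(_ u1).
by rewrite !powR1 mulr1; lra.
Qed.

(** The tangent inequality for the exponent 1 / p at the point (1 - u)^p. *)
Lemma bernoulli_le p u : 0 < p -> p <= 1 -> u <= 1 -> p * u <= 1 - (1 - u) `^ p.
Proof.
move=> p0 p1 u1; have u1' : 0 <= 1 - u by rewrite subr_ge0.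
have pV : 1 <= p^-1 by rewrite invf_ge1.
have := powR_tangent pV (powR_ge0 (1 - u) p) ler01.
rewrite !powR1 powRK ?gt_eqF// mulr1 -(ler_pM2l p0) mulrDr mulrA mulfV ?gt_eqF//.
by lra.
Qed.

End Bernoulli.

Section Two.
Context {R : realType}.
Implicit Types q p : R.

(** The sequence k^(-1/2), numbered from 0. Its square is the harmonic sequence, and
    its Lorentz norm of exponents 2 and q is of order (log n)^(1/q): it tells the
    exponents q apart. *)
Definition invsqrt (k : nat) : R := k.+1%:R `^ (- 2^-1).

Lemma invsqrt_gt0 k : 0 < invsqrt k.
Proof. by rewrite powR_gt0 ?ltr0n. Qed.

Lemma invsqrt_sqr k : invsqrt k ^+ 2 = k.+1%:R^-1.
Proof.
rewrite -powR_mulrn ?ltW ?invsqrt_gt0// -powRrM mulNr mulVf ?pnatr_eq0//.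
by rewrite powR_inv1// ler0n.
Qed.

Lemma sumsq_invsqrt n : sumsq n invsqrt = \sum_(k < n) k.+1%:R^-1.
Proof. by apply: eq_bigr => k _; rewrite invsqrt_sqr. Qed.

Lemma decr_rearr_invsqrt n k : (k < n)%N ->
  decr_rearr (vec n invsqrt) k = invsqrt k.
Proof.
move=> kn; rewrite (decr_rearr_sorted (l := absvals (vec n invsqrt)))//.
  by rewrite nth_absvals_vec// gtr0_norm ?invsqrt_gt0.
apply/(sortedP 0) => i; rewrite size_absvals => ni.
rewrite /= !nth_absvals_vec ?(ltnW ni)// !gtr0_norm ?invsqrt_gt0//.
rewrite /invsqrt !powRN lef_pV2 ?posrE ?powR_gt0 ?ltr0n//.
by rewrite ler_powR2 ?ler0n ?invr_ge0// ler_nat.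
Qed.

Lemma lorentz_invsqrt q n : 0 < q ->
  lorentz_norm 2 q (vec n invsqrt) `^ q =
  \sum_(k < n) (1 - (1 - k.+1%:R^-1) `^ (q / 2)).
Proof.
move=> q0; rewrite powRVK ?gt_eqF//; last first.
  apply: sumr_ge0 => i _; rewrite mulr_ge0 ?powR_ge0// weight_ge0//.
  by rewrite divr_ge0 ?ltW.
apply: eq_bigr => k _; rewrite decr_rearr_invsqrt//.
have k0 : 0 < k.+1%:R :> R by rewrite ltr0n.
have e : 1 - k.+1%:R^-1 = k%:R / k.+1%:R :> R.
  by rewrite -natr1; field; rewrite natr1 gt_eqF.
rewrite e powRM ?invr_ge0 ?ler0n// powR_inv ?ler0n//.
rewrite /invsqrt -powRrM (_ : - 2^-1 * q = - (q / 2)); last by ring.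
by rewrite powRN; field; rewrite gt_eqF// powR_gt0.
Qed.

Lemma lorentz_invsqrt_le q n : 2 <= q ->
  lorentz_norm 2 q (vec n invsqrt) `^ q <= q / 2 * \sum_(k < n) k.+1%:R^-1.
Proof.
move=> q2; rewrite lorentz_invsqrt ?(lt_le_trans _ q2)// mulr_sumr.
apply: ler_sum => k _; apply: bernoulli_ge; first by rewrite ler_pdivlMr// mul1r.
by rewrite invf_le1 ?ltr0n// ler1n.
Qed.

Lemma lorentz_invsqrt_ge q n : 0 < q -> q <= 2 ->
  q / 2 * \sum_(k < n) k.+1%:R^-1 <= lorentz_norm 2 q (vec n invsqrt) `^ q.
Proof.
move=> q0 q2; rewrite lorentz_invsqrt// mulr_sumr.
apply: ler_sum => k _; apply: bernoulli_le.
- by rewrite divr_gt0.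
- by rewrite ler_pdivrMr// mul1r.
by rewrite invf_le1 ?ltr0n// ler1n.
Qed.

Lemma lorentz_norm_perm s q n (a b : 'rV[R]_n) (sigma : 'I_n -> 'I_n) :
  injective sigma -> (forall i, `|b 0 i| = `|a 0 (sigma i)|) ->
  lorentz_norm s q b = lorentz_norm s q a.
Proof.
move=> sinj ba; rewrite /lorentz_norm; congr (_ `^ _); apply: eq_bigr => k _.
congr (_ `^ _ * _); apply: decr_rearr_perm.
rewrite /absvals; under eq_map do rewrite ba.
rewrite (map_comp (fun i => `|a 0 i|) sigma); apply: perm_map.
apply: uniq_perm; rewrite ?(map_inj_uniq sinj) ?enum_uniq// => i.
rewrite mem_enum [RHS]inE; apply/mapP; exists (invF sinj i).
  by rewrite mem_enum.
by rewrite f_invF.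
Qed.

End Two.

Section LorentzTwo.
Context {R : realType} {r : R} {r1 : (1 <= r%:E)%E}.
Local Notation ell := (@ell R r r1).

(** If the c_k are the rotations of one sequence, averaging over k flattens it: by
    Jensen's inequality the average is, up to a constant, at least what the constant
    sequence with the same sum of squares H would give. *)
Lemma avg_ge_rotations n (c : nat -> nat -> R) (H : R) (X : nat -> ell) :
  2 < r -> (0 < n)%N -> 0 <= H ->
  (forall i, (i < n)%N -> \sum_(k < n) c k i ^+ 2 = H) ->
  (H / n%:R) `^ (r / 2) * avg 1 n X <=
  2 * rosenthal_const r *
    \sum_(k < n) n%:R^-1 * avg 1 n (fun i => c k i *: X i).
Proof.
move=> r2 n0 H0 hc; have n0' : 0 < n%:R :> R by rewrite ltr0n.
rewrite {2}/avg.
under eq_bigr do under eq_expect do under eq_bigr do rewrite scalerA.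
move: X; apply: lifts_le.
- by apply: lifts_scale; exact: lifts_avg.
- apply: lifts_scale; apply: lifts_sum => k; apply: lifts_scale.
  by apply: lifts_expect => xi; exact: (@lifts_pnorm _ _ _ n (fun i => xi i * c k i)).
move=> t; apply: (@le_trans _ _ ((H / n%:R) `^ (r / 2) *
    (2 * rosenthal_const r * sumsq n t `^ (r / 2)))).
  by rewrite ler_wpM2l ?powR_ge0// khintchine_upper.
rewrite mulrCA ler_wpM2l ?mulr_ge0 ?rosenthal_const_ge0//.
rewrite -powRM ?sumsq_ge0 ?divr_ge0 ?(ltW n0')//.
have w1 : \sum_(i < n) (n%:R^-1 : R) = 1.
  by rewrite sumr_const card_ord -[_ *+ n]mulr_natr mulVf// gt_eqF.
have w0 (i : nat) : 0 <= n%:R^-1 :> R by rewrite invr_ge0 ltW.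
have p1 : 1 <= r / 2 by rewrite ler_pdivlMr// mul1r ltW.
have -> : H / n%:R * sumsq n t =
    \sum_(k < n) n%:R^-1 * sumsq n (fun i => c k i * t i).
  rewrite -mulr_sumr mulrAC mulrC; congr (_ * _); rewrite exchange_big mulr_sumr.
  apply: eq_bigr => i _; rewrite -(hc i (ltn_ord i)) mulr_suml.
  by apply: eq_bigr => k _; rewrite exprMn.
have := jensen_sum w0 w1 p1 (fun k => sumsq_ge0 n (fun i => c k i * t i)).
move/le_trans; apply.
apply: ler_sum => k _; rewrite ler_wpM2l//.
apply: (le_trans (expect_walk_ge n (fun i => c k i * t i) (ltW r2))).
rewrite le_eqVlt; apply/orP; left; apply/eqP; apply: eq_expect => xi.
by congr (`| _ | `^ _); apply: eq_bigr => i _; rewrite mulrA.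
Qed.

(** The type 2 of ell_r bounds the norm of a = k^(-1/2) by a multiple of its
    euclidean norm (log n)^(1/2). Conversely, sign averages of order n^(r/2) and the
    invariance of the norm under rotations bound it from below by a multiple of
    (log n)^(1/2). The norm is of order (log n)^(1/q), so the first bound fails for
    q < 2 and the second for q > 2. *)
Lemma no_lorentz2_embedding q : 2 < r -> 1 <= q -> q <> 2 ->
  ~ @bounded_embeddings R r r1 (lorentz_norm 2 q).
Proof.
move=> r2 q1 q2 emb; have q0 : 0 < q by rewrite (lt_le_trans _ q1).
have r0 : 0 < r by rewrite (lt_trans _ r2).
have NE0 n a : 0 <= @lorentz_norm R 2 q n a by exact: lorentz_ge0.
have [M M0 hM] := bounded_embeddings_pnorm NE0 emb.
pose K := 2 * rosenthal_const r.
have K0 : 0 <= K by rewrite mulr_ge0 ?rosenthal_const_ge0.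
pose H n : R := \sum_(k < n) k.+1%:R^-1.
pose N n := lorentz_norm 2 q (vec n (@invsqrt R)).
have HE n : sumsq n invsqrt = H n by exact: sumsq_invsqrt.
have H0 n : 0 <= H n by rewrite -HE sumsq_ge0.
have flat2 : power_on_flat 2 (@lorentz_norm R 2 q) by exact: lorentz_flat.
have NrE n : (N n `^ q) `^ (r / q) = N n `^ r.
  by rewrite -powRrM mulrCA divff ?mulr1// gt_eqF.
have c0 : 0 < (q / 2) `^ (r / q) by rewrite powR_gt0// divr_gt0.
have rq0 : 0 <= r / q by rewrite divr_ge0// ltW.
have [q_lt2|q_gt2] : q < 2 \/ 2 < q.
- by move/eqP: q2; rewrite neq_lt => /orP.
- pose C := K * M / (q / 2) `^ (r / q).
  have ab : r / 2 < r / q by rewrite ltr_pM2l// ltf_pV2 ?posrE.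
  have [n n0 Hn] := harmonic_sum_unbounded (`|C| `^ (r / q - r / 2)^-1).
  have := powR_growth ab Hn; rewrite -/(H n); apply/negP; rewrite -leNgt.
  have [X hX] := hM n n0; have [h1 /andP[low _] _] := flat_bounds flat2 hX.
  rewrite /C mulrAC ler_pdivlMr// -mulrA [leLHS]mulrC -powRM ?divr_ge0 ?(ltW q0)//.
  apply: (@le_trans _ _ (N n `^ r)).
    rewrite -NrE; apply: ler_powR2 => //; first by rewrite mulr_ge0// divr_ge0// ltW.
    by apply: lorentz_invsqrt_ge => //; exact: ltW.
  apply: (@le_trans _ _ (avg 1 n (fun i => invsqrt i *: X i))).
    rewrite -[leLHS](expect_cst 1 n); apply: le_expect_signs => xi hx.
    under eq_bigr do rewrite scalerA.
    have /andP[+ _] := hX (fun i => xi i * invsqrt i).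
    rewrite (lorentz_norm_perm (a := vec n invsqrt) _ _ (sigma := id))//.
    by move=> i; rewrite !mxE normrM hx// mul1r.
  apply: (le_trans (avg_le_weighted n _ X r2)); rewrite -/K ler_wpM2l//.
  rewrite HE -[X in _ <= _ * X](mulr_powRB1 (H0 n) (divr_gt0 r0 (ltr0Sn R 1))).
  rewrite mulrA [leRHS]mulrC ler_wpM2l ?powR_ge0// mulrC -{1}HE mulr_suml.
  by apply: ler_sum => i _; rewrite ler_wpM2l ?sqr_ge0//; case/andP: (h1 i (ltn_ord i)).
- pose C := K * M * (q / 2) `^ (r / q).
  have ab : r / q < r / 2 by rewrite ltr_pM2l// ltf_pV2 ?posrE.
  have [[//|m] n0 Hn] := harmonic_sum_unbounded (`|C| `^ (r / 2 - r / q)^-1).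
  set n := m.+1 in n0 Hn; have n0' : 0 < n%:R :> R by rewrite ltr0n.
  have := powR_growth ab Hn; rewrite -/(H n); apply/negP; rewrite -leNgt.
  have [X hX] := hM n n0; have [h1 /andP[low _] _] := flat_bounds flat2 hX.
  (* the sum of indices in 'I_n is taken modulo n *)
  pose c (k i : nat) : R := invsqrt (inord i + inord k : 'I_n)%R.
  have hc i : (i < n)%N -> \sum_(k < n) c k i ^+ 2 = H n.
    move=> ni; rewrite -HE /sumsq [RHS](reindex_inj (addrI (inord i : 'I_n))).
    by apply: eq_bigr => k _; rewrite /c inord_val.
  have := avg_ge_rotations X r2 n0 (H0 n) hc.
  have up : \sum_(k < n) n%:R^-1 * avg 1 n (fun i => c k i *: X i) <= M * N n `^ r.
    have -> : M * N n `^ r = \sum_(k < n) n%:R^-1 * (M * N n `^ r).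
      by rewrite sumr_const card_ord -[_ *+ n]mulr_natr mulrAC mulVf ?mul1r// gt_eqF.
    apply: ler_sum => k _; rewrite ler_wpM2l ?invr_ge0 ?(ltW n0')//.
    rewrite -[leRHS](expect_cst 1 n); apply: le_expect_signs => xi hx.
    under eq_bigr do rewrite scalerA.
    have /andP[_] := hX (fun i => xi i * c k i).
    rewrite (lorentz_norm_perm (a := vec n invsqrt) _ _
      (sigma := fun i : 'I_n => (i + inord k)%R))//; first exact: addIr.
    by move=> i; rewrite !mxE normrM hx// mul1r /c inord_val.
  move=> main; have {main} : H n `^ (r / 2) <= K * (M * N n `^ r).
    apply: le_trans (le_trans main (ler_wpM2l K0 up)).
    rewrite -{1}(divfK (lt0r_neq0 n0') (H n)).
    by rewrite [leLHS]powRM ?divr_ge0 ?(ltW n0')// ler_wpM2l ?powR_ge0.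
  move/le_trans; apply.
  have -> : C * H n `^ (r / q) = K * (M * ((q / 2) `^ (r / q) * H n `^ (r / q))).
    by rewrite /C; ring.
  apply: ler_wpM2l => //; apply: ler_wpM2l => //.
  rewrite -powRM ?divr_ge0 ?(ltW q0)// -NrE.
  by apply: ler_powR2 => //; [exact: powR_ge0|apply: lorentz_invsqrt_le; exact: ltW].
Qed.

End LorentzTwo.

(** * The embeddings of ell_r and ell_2, and the theorem *)

Section Positive.
Context {R : realType} {r : R} {r1 : (1 <= r%:E)%E}.
Local Notation ell := (@ell R r r1).

Lemma outcomes_ge0 (d : R) n : 0 <= d <= 1 ->
  all (fun p => 0 <= p.1) (outcomes d n).
Proof.
move=> /andP[d0 d1]; elim: n => [|n IH] /=; first by rewrite ler01.
elim: (outcomes d n) IH => //= p s IHs /andP[p0 /IHs ->].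
by rewrite !mulr_ge0 ?divr_ge0 ?subr_ge0.
Qed.

Lemma lnorm_vec s n (a : nat -> R) :
  lnorm s (vec n a) = sumpow n a s `^ s^-1.
Proof. by congr (_ `^ _); apply: eq_bigr => i _; rewrite mxE. Qed.

Lemma embeds_ell_r : embeds_uniformly (lnorm r) (@ell_norm R r r1).
Proof.
have r0 := r_gt0 (r1 := r1).
apply: vectors_embed_uniformly.
- by move=> n a; exact: lnorm_ge0.
- by move=> n a; exact: lnorm_eq0.
exists 1 => // n _; exists (fun i => unitv i) => a.
by rewrite mul1r ell_normE pnorm_unitv lnorm_vec lexx.
Qed.

(** The vectors of values of the n random signs over the outcomes. The r-th root of
    the probability in each coordinate turns the norm into an r-th moment. *)
Lemma rademacher_vectors n : exists X : nat -> ell, forall a : nat -> R,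
  pnorm (\sum_(i < n) a i *: X i) = expect 1 n (fun xi => `|walk n a xi| `^ r).
Proof.
have r0 := r_gt0 (r1 := r1).
pose L := outcomes (1 : R) n; pose p j := nth (0, fun=> 0) L j.
exists (fun i => \sum_(j < size L) ((p j).1 `^ r^-1 * (p j).2 i) *: unitv j) => a.
have -> : \sum_(i < n) a i *:
    (\sum_(j < size L) ((p j).1 `^ r^-1 * (p j).2 i) *: unitv j) =
    \sum_(j < size L) ((p j).1 `^ r^-1 * walk n a (p j).2) *: unitv j :> ell.
  under eq_bigr do rewrite scaler_sumr.
  rewrite exchange_big; apply: eq_bigr => j _.
  rewrite mulr_sumr scaler_suml; apply: eq_bigr => i _.
  by rewrite scalerA; congr (_ *: _); ring.
rewrite (pnorm_unitv _ (fun j => (p j).1 `^ r^-1 * walk n a (p j).2)).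
rewrite /expect (big_nth (0, fun=> 0)) big_mkord.
apply: eq_bigr => j _; rewrite normrM powRM// ger0_norm ?powR_ge0//.
rewrite powRVK ?gt_eqF//.
have d1 : 0 <= (1 : R) <= 1 by rewrite ler01 lexx.
exact: (all_nthP _ (outcomes_ge0 n d1)).
Qed.

(** Both halves of Khintchine's inequality, which say that the moment in
    [rademacher_vectors] is equivalent to the euclidean norm. *)
Lemma embeds_ell_2 : 2 < r -> embeds_uniformly (lnorm 2) (@ell_norm R r r1).
Proof.
move=> r2; have r0 := r_gt0 (r1 := r1).
apply: vectors_embed_uniformly.
- by move=> n a; exact: lnorm_ge0.
- by move=> n a; exact: lnorm_eq0.
pose K := 2 * rosenthal_const r.
have K0 : 0 <= K by rewrite mulr_ge0 ?rosenthal_const_ge0.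
exists (K `^ r^-1); first exact: powR_ge0.
move=> n _; have [X hX] := rademacher_vectors n; exists X => a.
have rV0 : 0 <= r^-1 by rewrite invr_ge0 ltW.
have -> : lnorm 2 (vec n a) = (sumsq n a `^ (r / 2)) `^ r^-1.
  rewrite lnorm_vec -powRrM (_ : r / 2 * r^-1 = 2^-1); last by field; rewrite gt_eqF.
  by congr (_ `^ _); apply: eq_bigr => i _; rewrite powR_mulrn// real_normK ?num_real.
rewrite -powRM ?powR_ge0// ell_normE hX; apply/andP; split.
  by apply: ler_powR2; rewrite ?powR_ge0// expect_walk_ge// ltW.
apply: ler_powR2 => //; last exact: khintchine_upper.
by apply: expect_ge0 => [|xi]; rewrite ?ler01 ?lexx ?powR_ge0.
Qed.

Lemma no_lnorm_embedding s : 0 < s -> s <> 2 ->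
  (s < Num.min 2 r) \/ (Num.max 2 r < s) \/ (2 < r /\ s <> r) ->
  ~ embeds_uniformly (lnorm s) (@ell_norm R r r1).
Proof.
move=> s0 s2 hs /embeds_uniformly_vectors h.
apply: (no_flat_embedding _ (lnorm_flat s0) s0 s2 hs).
  by move=> n a; exact: lnorm_ge0.
apply: h => //; first exact: lnorm_homogeneous.
  by move=> n a; exact: lnorm_ge0.
by move=> n; rewrite (power_on_flat_delta _ (lnorm_flat s0)).
Qed.

Lemma no_lorentz_embedding s q : 0 < s -> 1 <= q -> ~ (s = 2 /\ q = 2) ->
  (s < Num.min 2 r) \/ (Num.max 2 r < s) \/ (2 < r /\ s <> r) ->
  ~ embeds_uniformly (lorentz_norm s q) (@ell_norm R r r1).
Proof.
move=> s0 q1 sq hs emb; have q0 : 0 < q by rewrite (lt_le_trans _ q1).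
have NE0 n a : 0 <= @lorentz_norm R s q n a by exact: lorentz_ge0.
have fl := lorentz_flat s0 q0.
have emb' : @bounded_embeddings R r r1 (lorentz_norm s q).
  apply: embeds_uniformly_vectors => //; first exact: lorentz_homogeneous.
  by move=> n; rewrite (power_on_flat_delta _ fl).
have [s2|/eqP s2] := eqVneq s 2; last exact: (no_flat_embedding NE0 fl s0 s2 hs).
have r2 : 2 < r.
  move: hs; rewrite s2 => -[|[|[]//]].
    by rewrite lt_min ltxx.
  by rewrite gt_max ltxx.
move: emb'; rewrite s2; apply: no_lorentz2_embedding => // q2.
exact: sq.
Qed.

End Positive.

Theorem corollary3p3 (R : realType) (r : R) (r1 : (1 <= r%:E)%E) :
  (2 < r -> forall s : R, 0 < s ->
     (embeds_uniformly (lnorm s) (@ell_norm R r r1) <-> s = r \/ s = 2))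
  /\
  (forall s : R, 0 < s ->
     (1 < s /\ s < Num.min 2 r) \/ Num.max 2 r < s \/ (2 < r /\ s <> r) ->
     (forall q : R, 1 <= q -> ~ (s = 2 /\ q = 2) ->
        ~ embeds_uniformly (lorentz_norm s q) (@ell_norm R r r1))
     /\
     (s <> 2 -> ~ embeds_uniformly (lnorm s) (@ell_norm R r r1))).
Proof.
split=> [r2 s s0|s s0 hs].
  split=> [emb|[->|->]]; [|exact: embeds_ell_r|exact: embeds_ell_2].
  have [->|/eqP sr] := eqVneq s r; first by left.
  have [->|/eqP s2] := eqVneq s 2; first by right.
  by have := no_lnorm_embedding s0 s2 (or_intror (or_intror (conj r2 sr))) emb.
have hs' : (s < Num.min 2 r) \/ (Num.max 2 r < s) \/ (2 < r /\ s <> r).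
  by case: hs => [[_ ?]|?]; [left|right].
split=> [q q1 sq|s2].
  exact: no_lorentz_embedding.
exact: no_lnorm_embedding.
Qed.
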